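(* Let $G$ be a finite simplicial graph, let $\Gamma=A(G)$ be the associated right-angled Artin group, let $X$ be the universal covering of the Salvetti complex of $G$, and let $x$ be a vertex of $X$. Let $F\subset V(G)$ be an independent set of vertices of $G$ (no two of its elements are joined by an edge) with $|F|\geq2$. Let $B_F\subset H^2_b(\Gamma;\mathbb{R})$ be the linear span of the classes $[\delta^1\widehat{f_{s,x}}]$, where $s=(h_1\supset\cdots\supset h_l)$ ranges over all $\mathcal{H}$-segments in $X$ (of any length $l\ge1$) with $\lambda(h_1),\lambda(h_l)\in F$. Then $\dim B_F=\infty$, and for all $\varphi,\psi\in B_F$ we have $$\varphi\cup\psi=0\in H^4_b(\Gamma;\mathbb{R}).$$
   Context: Bounded cohomology: $C^n_b(\Gamma;\mathbb{R}):=\ell^\infty(\Gamma^{n+1},\mathbb{R})^\Gamma$ with the simplicial coboundary; $H^*_b(\Gamma;\mathbb{R})$ is its cohomology; the cup product is induced by $(f\cup g)(\gamma_0,\dots,\gamma_{p+q})=f(\gamma_0,\dots,\gamma_p)\,g(\gamma_p,\dots,\gamma_{p+q})$. RAAGs: $A(G)=\langle V(G)\mid vw=wv \text{ for } \{v,w\}\in E(G)\rangle$. The Salvetti complex $S(G)$ is the non-positively curved cube complex obtained from the presentation complex by gluing in a $k$-cube ($k$-torus) for each $k$-clique of $G$. Its universal covering $X$ is a $\mathrm{CAT}(0)$ cube complex: its $1$-skeleton is the Cayley graph of $\Gamma$ with respect to $V(G)$ (edges $\{g,gv\}$), it has one cube spanned by $\{g\prod_{v\in B}v : B\subseteq C\}$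 for each $g\in\Gamma$ and each clique $C$, and $\Gamma$ acts freely by left multiplication. The label of the edge $\{g,gv\}$ is $v\in V(G)$. Halfspaces: let $D$ be the combinatorial path metric on the vertex set $V$ in the $1$-skeleton of $X$. For an edge $e$ with endpoints $a,b$, $V$ is the disjoint union of $\{v: D(v,a)<D(v,b)\}$ and $\{v: D(v,b)<D(v,a)\}$; each of these is called a halfspace, dual to $e$. All edges dual to the same halfspace $h$ have the same label, denoted $\lambda(h)$. For $x,y\in V$, $[x,y]_{\mathcal{H}}$ is the (finite) set of halfspaces containing $y$ but not $x$. Halfspaces $h\supset k$ are tightly nested if they are distinct and there is no halfspace $h'\neq h,k$ with $h\supset h'\supset k$. An $\mathcal{H}$-segment of length $l\geq1$ is a sequence $(h_1\supset\cdots\supset h_l)$ of halfspaces with consecutive ones tightly nested. Elements of $\Gamma s$ are called translates of $s$; a segment is contained in $[x,y]_{\mathcal{H}}$ if all its halfspaces are. Median quasimorphisms: $f_s(x,y)$ is the number of translates of $s$ contained in $[x,y]_{\mathcal{H}}$ minus the number of translates of $s$ contained in $[y,x]_{\mathcal{H}}$, and $f_{s,x}\colon\Gamma\to\mathbb{R}$, $f_{s,x}(\gamma):=f_s(x,\gamma x)$. This is a quasimorphism. For a quasimorphism $f$, $\widehat f(\gamma_0,\gamma_1):=f(\gamma_0^{-1}\gamma_1)$, and $\delta^1\widehat f$ is a bounded cocycle defining a class in $H^2_b(\Gamma;\mathbb{R})$. *)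

(* Defs.v *)
From HB Require Import structures.
From mathcomp Require Import all_boot all_order all_algebra finmap ring.
From mathcomp Require Import boolp classical_sets functions cardinality reals.

Set Implicit Arguments.
Unset Strict Implicit.
Unset Printing Implicit Defensive.

Import Order.TTheory GRing.Theory Num.Theory.

Local Open Scope classical_set_scope.
Local Open Scope quotient_scope.
Local Open Scope ring_scope.

Section LinearSpan.
Variables (R : pzRingType) (U : lmodType R).
Implicit Type A : set U.

Definition lspan A : set U :=
  [set u | exists n (c : 'I_n -> R) (w : 'I_n -> U),
     (forall i, A (w i)) /\ u = \sum_(i < n) c i *: w i].

Definition finite_dim A : Prop := exists s : seq U, A = lspan [set` s].

End LinearSpan.

Definition cochain (R : realType) (G : groupType) (n : nat) : Type :=
  ('I_n.+1 -> G) -> R^o.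

HB.instance Definition _ R G n := GRing.Lmodule.on (@cochain R G n).

Section Cochains.
Variables (R : realType) (G : groupType).

Definition invariant_cochain n (f : cochain R G n) : Prop :=
  forall (a : G) (g : 'I_n.+1 -> G), f (fun i => (a * g i)%g) = f g.

Definition bounded_cochain n (f : cochain R G n) : Prop :=
  exists M : R, forall g, `|f g| <= M.

Definition delta n (f : cochain R G n) : cochain R G n.+1 :=
  fun g => \sum_(i < n.+2) (-1) ^+ i * f (fun j => g (lift i j)).

Definition cochain_cup p q (f : cochain R G p) (g : cochain R G q) :
    cochain R G (p + q) :=
  fun c => f (fun i => c (inord i)) * g (fun j => c (inord (p + j))).

Definition bcochain n : {pred cochain R G n} :=
  [pred f | `[< invariant_cochain f /\ bounded_cochain f >]].
Arguments bcochain : clear implicits.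

Definition bcocycle n : {pred cochain R G n} :=
  [pred f | (f \in bcochain n) && (delta f == 0)].
Arguments bcocycle : clear implicits.

Definition is_bcoboundary n : cochain R G n -> Prop :=
  match n with
  | 0 => fun f => f = 0
  | m.+1 => fun f => exists2 h : cochain R G m, h \in bcochain m & f = delta h
  end.

Lemma bcochainP n (f : cochain R G n) :
  reflect (invariant_cochain f /\ bounded_cochain f) (f \in bcochain n).
Proof. exact: asboolP. Qed.

Lemma bcocycleE n (f : cochain R G n) :
  (f \in bcocycle n) = (f \in bcochain n) && (delta f == 0).
Proof. by []. Qed.

Lemma delta_linear n : linear (@delta n).
Proof.
move=> a f g; apply/funext => c; rewrite /delta.
transitivity (a * \sum_(i < n.+2) (-1) ^+ i * f (fun j => c (lift i j))
  + \sum_(i < n.+2) (-1) ^+ i * g (fun j => c (lift i j))); last by [].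
rewrite mulr_sumr -big_split /=; apply: eq_bigr => i _.
transitivity ((-1) ^+ i * (a * f (fun j => c (lift i j))
  + g (fun j => c (lift i j)))); first by [].
by rewrite mulrDr mulrCA.
Qed.

HB.instance Definition _ n := GRing.isLinear.Build R
  (cochain R G n) (cochain R G n.+1) *:%R (@delta n) (@delta_linear n).

Lemma bcochain_submod_closed n : submod_closed (bcochain n).
Proof.
split.
  by apply/bcochainP; split=> [//|]; exists 0 => g; rewrite normr0.
move=> a f g /bcochainP[fi [M fM]] /bcochainP[gi [N gN]]; apply/bcochainP; split.
  move=> b c; transitivity (a * f (fun i => (b * c i)%g) + g (fun i => (b * c i)%g)) => //.
  by rewrite fi gi.
exists (`|a| * M + N) => c.
apply: le_trans (ler_normD (a * f c) (g c)) _.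
by rewrite lerD ?normrM ?ler_wpM2l.
Qed.

Lemma bcocycle_submod_closed n : submod_closed (bcocycle n).
Proof.
have [c0 cD] := bcochain_submod_closed n.
split; first by rewrite bcocycleE c0 linear0 eqxx.
move=> a f g; rewrite !bcocycleE => /andP[fb /eqP df] /andP[gb /eqP dg].
by rewrite cD // delta_linear df dg scaler0 addr0 eqxx.
Qed.

HB.instance Definition _ n := GRing.isSubmodClosed.Build R
  (cochain R G n) (bcocycle n) (@bcocycle_submod_closed n).

End Cochains.

Arguments bcochain : clear implicits.
Arguments bcocycle : clear implicits.

Section Cocycles.
Variables (R : realType) (G : groupType) (n : nat).

Record bZ : Type := BZ { bZ_val :> cochain R G n; _ : bZ_val \in bcocycle R G n }.

HB.instance Definition _ := [isSub for bZ_val].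
HB.instance Definition _ := [Choice of bZ by <:].
HB.instance Definition _ := [SubChoice_isSubLmodule of bZ by <:].

Definition bB : {pred bZ} := [pred z : bZ | `[< is_bcoboundary (z : cochain R G n) >]].

Lemma bB_submod_closed : submod_closed bB.
Proof.
rewrite /bB; split.
  apply/asboolP; rewrite /= /is_bcoboundary; case: n => [//|m].
  exists 0; last by rewrite linear0.
  by have [] := bcochain_submod_closed R G m.
move=> a [u uZ] [v vZ] /asboolP/= uB /asboolP/= vB; apply/asboolP => /=.
case: n u v uB vB {uZ vZ} => [u v -> ->|m u v [h hb ->] [k kb ->]].
  by rewrite /= scaler0 addr0.
exists (a *: h + k); last by rewrite delta_linear.
by have [_] := bcochain_submod_closed R G m; apply.
Qed.

HB.instance Definition _ := GRing.isSubmodClosed.Build R bZ bB bB_submod_closed.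

Definition Hb : Type := Quotient.quot bB.

HB.instance Definition _ := GRing.Zmodule.on Hb.

Definition bclass (z : bZ) : Hb := \pi_(Quotient.quot bB) z.

Lemma bclassB : {morph bclass : u v / u - v}.
Proof. exact: (raddfB (\pi_(Quotient.quot bB))). Qed.

Lemma bclassD : {morph bclass : u v / u + v}.
Proof. exact: (raddfD (\pi_(Quotient.quot bB))). Qed.

Lemma bclass_repr (phi : Hb) : bclass (repr phi) = phi.
Proof. exact: reprK. Qed.

Lemma bclass_eqP (u v : bZ) :
  bclass u = bclass v <-> is_bcoboundary (bZ_val (u - v)).
Proof.
split=> [/eqP|uvB]; last first.
  by apply/eqP; rewrite -(Quotient.idealrBE bB); apply/asboolP.
by rewrite -Quotient.idealrBE => /asboolP.
Qed.

Definition Hb_scale (a : R) (phi : Hb) : Hb := bclass (a *: repr phi).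

Lemma Hb_scale_bclass a (z : bZ) : Hb_scale a (bclass z) = bclass (a *: z).
Proof.
apply/eqP; rewrite -Quotient.idealrBE -scalerBr.
by rewrite rpredZ // Quotient.idealrBE reprK.
Qed.

Lemma Hb_scaleA a b (phi : Hb) : Hb_scale a (Hb_scale b phi) = Hb_scale (a * b) phi.
Proof. by rewrite -[phi]bclass_repr !Hb_scale_bclass scalerA. Qed.

Lemma Hb_scale1 : left_id 1 Hb_scale.
Proof. by move=> phi; rewrite -[phi]bclass_repr Hb_scale_bclass scale1r. Qed.

Lemma Hb_scaleDr : right_distributive Hb_scale +%R.
Proof.
move=> a phi psi; rewrite -[phi]bclass_repr -[psi]bclass_repr.
by rewrite -bclassD !Hb_scale_bclass -bclassD scalerDr.
Qed.

Lemma Hb_scaleDl (phi : Hb) : {morph Hb_scale^~ phi : a b / a + b}.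
Proof.
by move=> a b; rewrite -[phi]bclass_repr !Hb_scale_bclass -bclassD scalerDl.
Qed.

HB.instance Definition _ := GRing.Zmodule_isLmodule.Build R Hb
  Hb_scaleA Hb_scale1 Hb_scaleDr Hb_scaleDl.

Lemma bclassZ a (z : bZ) : bclass (a *: z) = a *: bclass z.
Proof. by rewrite -Hb_scale_bclass. Qed.

End Cocycles.

Arguments bZ : clear implicits.
Arguments bB : clear implicits.
Arguments Hb : clear implicits.

Section CupProduct.
Variables (R : realType) (G : groupType).

Lemma cochain_cup_bcochain p q (f : cochain R G p) (g : cochain R G q) :
  f \in bcochain R G p -> g \in bcochain R G q ->
  cochain_cup f g \in bcochain R G (p + q).
Proof.
move=> /bcochainP[fi [M fM]] /bcochainP[gi [N gN]]; apply/bcochainP; split.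
  move=> a c; rewrite /cochain_cup.
  by rewrite (fi a (fun i => c (inord i))) (gi a (fun j => c (inord (p + j)))).
exists (M * N) => c; rewrite /cochain_cup normrM.
by rewrite ler_pM.
Qed.

Lemma delta_cup p q (f : cochain R G p) (g : cochain R G q) (c : 'I_(p + q).+2 -> G) :
  delta (cochain_cup f g) c =
    delta f (fun i => c (inord i)) * g (fun j => c (inord (p.+1 + j)))
  + (-1) ^+ p * (f (fun i => c (inord i)) * delta g (fun j => c (inord (p + j)))).
Proof.
pose s k := c (inord k).
pose A i : R := (-1) ^+ i * f (fun k : 'I_p.+1 => s (bump i k)).
pose B i : R := (-1) ^+ i * g (fun k : 'I_q.+1 => s (p + bump i k)%N).
have deltaf : delta f (fun i => c (inord i)) = \sum_(i < p.+2) A i by [].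
have deltag : delta g (fun j => c (inord (p + j))) = \sum_(i < q.+2) B i by [].
have deltafg : delta (cochain_cup f g) c =
  \sum_(0 <= i < (p + q).+2) (-1) ^+ i *
    (f (fun k : 'I_p.+1 => s (bump i k)) * g (fun k : 'I_q.+1 => s (bump i (p + k)%N))).
  rewrite big_mkord; apply: eq_bigr => i _; rewrite /cochain_cup.
  congr (_ * (f _ * g _)); apply/funext => k; rewrite /s; congr c; apply: val_inj => /=.
    by rewrite !inordK // /bump; case: k => k /= kp; case: (i <= k)%N => /=;
      rewrite ?add0n ?add1n ?ltnS; rewrite ?ltnS in kp;
      rewrite ?(leq_trans kp) // ?leqW ?leq_addr.
  by rewrite !inordK // /bump; case: k => k /= kq; case: (i <= _)%N => /=;
    rewrite ?add0n ?add1n ?ltnS ?leq_add2l; rewrite ?ltnS in kq;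
    rewrite ?leqW // ?leq_add2l.
rewrite deltafg deltaf deltag (big_cat_nat (n := p.+1)) //=; last by rewrite ltnS leqW ?leq_addr.
rewrite (big_ord_recr p.+1) /= mulrDl (big_ord_recl q.+1) /= mulrDr mulrDr.
rewrite -addrA; congr (_ + _).
  rewrite big_mkord mulr_suml; apply: eq_bigr => i _; rewrite -mulrA.
  congr (_ * (_ * g _)); apply/funext => k; congr s.
  by rewrite /bump (leq_trans _ (leq_addr _ _)) // -ltnS.
rewrite addrA -[LHS]add0r; congr (_ + _).
  rewrite /A /B expr0 mul1r exprS mulN1r !mulNr -mulrA [X in - X + _](_ : _ =
    (-1) ^+ p * (f (fun k : 'I_p.+1 => s k) * g (fun k : 'I_q.+1 => s (p + bump 0 k)%N))).
    by rewrite addNr.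
  congr (_ * (f _ * g _)); apply/funext => k; congr s.
    by rewrite /bump leqNgt ltn_ord.
  by rewrite /bump /= addnS.
rewrite -{1}[p.+1]add0n big_addn mulr_sumr mulr_sumr.
have -> : ((p + q).+2 - p.+1 = q.+1)%N by rewrite subSS -addnS addKn.
rewrite big_mkord; apply: eq_bigr => i _; rewrite /B.
rewrite [in RHS](mulrCA (f _)) (mulrA ((-1) ^+ p)) -exprD.
rewrite {1}(_ : (i + p.+1 = p + lift ord0 i)%N); last first.
  by rewrite /= /bump /= addnCA addnC.
congr (_ * (f _ * g _)); apply/funext => k; congr (c (inord _)).
  by rewrite /bump leqNgt (leq_trans (ltn_ord k)) ?leq_addl.
rewrite /bump /= [RHS]addnCA; congr (nat_of_bool _ + _)%N.
by rewrite addnS -addSn addnC leq_add2l.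
Qed.

Lemma cochain_cup_bcocycle p q (f : cochain R G p) (g : cochain R G q) :
  f \in bcocycle R G p -> g \in bcocycle R G q ->
  cochain_cup f g \in bcocycle R G (p + q).
Proof.
rewrite !bcocycleE => /andP[fb /eqP df] /andP[gb /eqP dg].
rewrite cochain_cup_bcochain //=; apply/eqP/funext => c.
by rewrite delta_cup df dg mul0r mulr0 mulr0 addr0.
Qed.

Definition bZ_cup p q (u : bZ R G p) (v : bZ R G q) : bZ R G (p + q) :=
  BZ (cochain_cup_bcocycle (valP u) (valP v)).

Definition Hb_cup p q (phi : Hb R G p) (psi : Hb R G q) : Hb R G (p + q) :=
  bclass (bZ_cup (repr phi) (repr psi)).

Lemma is_bcoboundary0 n : is_bcoboundary (0 : cochain R G n).
Proof.
case: n => [//|m]; exists 0; last by rewrite linear0.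
by have [] := bcochain_submod_closed R G m.
Qed.

Lemma is_bcoboundary_ext n m (f : cochain R G n) (h : cochain R G m) :
  n = m.+1 -> h \in bcochain R G m ->
  (forall s : nat -> G, f (fun i => s i) = delta h (fun i => s i)) ->
  is_bcoboundary f.
Proof.
move=> nm hb; subst n => fh; exists h => //; apply/funext => c.
have -> : c = (fun i => (fun k => c (inord k)) (val i)).
  by apply/funext => i; rewrite inord_val.
exact: (fh (fun k => c (inord k))).
Qed.

Lemma bcoboundary_cupl p q (f : cochain R G p) (g : cochain R G q) :
  is_bcoboundary f -> g \in bcocycle R G q -> is_bcoboundary (cochain_cup f g).
Proof.
case: p f => [f -> _|p f [h hb ->]].
  rewrite (_ : cochain_cup _ _ = 0); first exact: is_bcoboundary0.
  by apply/funext => c; exact: mul0r.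
rewrite bcocycleE => /andP[gb /eqP dg].
exists (cochain_cup h g); first exact: cochain_cup_bcochain.
by apply/funext => c; rewrite delta_cup dg mulr0 mulr0 addr0.
Qed.

Lemma bcoboundary_cupr p q (f : cochain R G p) (g : cochain R G q) :
  f \in bcocycle R G p -> is_bcoboundary g -> is_bcoboundary (cochain_cup f g).
Proof.
rewrite bcocycleE => /andP[fb /eqP df]; case: q g => [g ->|q g [h hb ->]].
  rewrite (_ : cochain_cup _ _ = 0); first exact: is_bcoboundary0.
  by apply/funext => c; exact: mulr0.
have [c0 cD] := bcochain_submod_closed R G (p + q).
apply: (@is_bcoboundary_ext _ (p + q) _ ((-1) ^+ p *: cochain_cup f h)).
- by rewrite addnS.
- by rewrite -[_ *: _]addr0 cD // cochain_cup_bcochain.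
move=> s; rewrite linearZ /=.
rewrite -[RHS]/((-1) ^+ p * delta (cochain_cup f h) (fun i => s i)).
rewrite delta_cup df mul0r add0r mulrA -expr2 sqrr_sign mul1r.
rewrite /cochain_cup; congr (f _ * delta h _); apply/funext => k; congr s.
  by rewrite !inordK // ltnS (leq_trans (leq_ord k)) ?leqW ?leq_addr // addnS leqW ?leq_addr.
by rewrite !inordK // ?ltnS -?addnS leq_add2l leq_ord.
Qed.

Lemma Hb_cup_bclass p q (u : bZ R G p) (v : bZ R G q) :
  Hb_cup (bclass u) (bclass v) = bclass (bZ_cup u v).
Proof.
set u' := repr (bclass u); set v' := repr (bclass v).
have uB : is_bcoboundary (bZ_val (u' - u)) by apply/bclass_eqP/bclass_repr.
have vB : is_bcoboundary (bZ_val (v' - v)) by apply/bclass_eqP/bclass_repr.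
rewrite /Hb_cup -/u' -/v'; apply/bclass_eqP.
have := bcoboundary_cupl uB (valP v'); have := bcoboundary_cupr (valP u) vB.
pose w1 : bZ R G (p + q) := bZ_cup u (v' - v).
pose w2 : bZ R G (p + q) := bZ_cup (u' - u) v'.
move=> w1B w2B.
have : w1 + w2 \in bB R G (p + q) by rewrite rpredD //; apply/asboolP.
move=> /asboolP /=; congr is_bcoboundary; apply/funext => c.
set a := fun i : 'I_p.+1 => c (inord i); set b := fun j : 'I_q.+1 => c (inord (p + j)).
have E (x x' y y' : R) : x * (y' - y) + (x' - x) * y' = x' * y' - x * y by ring.
exact: (E (bZ_val u a) (bZ_val u' a) (bZ_val v b) (bZ_val v' b)).
Qed.

End CupProduct.

Arguments Hb_cup {R G p q} phi psi.

Section RAAG.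
Variables (V : finType) (E : rel V).

(* The letter [(v, true)] stands for v and [(v, false)] for its inverse. *)
Definition word := seq (V * bool).

Inductive raag_rel : word -> word -> Prop :=
| RaagRefl w : raag_rel w w
| RaagSym w1 w2 : raag_rel w1 w2 -> raag_rel w2 w1
| RaagTrans w1 w2 w3 : raag_rel w1 w2 -> raag_rel w2 w3 -> raag_rel w1 w3
| RaagCat w1 w2 w1' w2' :
    raag_rel w1 w1' -> raag_rel w2 w2' -> raag_rel (w1 ++ w2) (w1' ++ w2')
| RaagInv v b : raag_rel [:: (v, b); (v, ~~ b)] [::]
| RaagComm v w : E v w ->
    raag_rel [:: (v, true); (w, true)] [:: (w, true); (v, true)].

Definition raag_relb : rel word := fun w1 w2 => `[< raag_rel w1 w2 >].

Lemma raag_relb_equiv : equiv_class_of raag_relb.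
Proof.
split=> [w|w1 w2|w2 w1 w3]; first by apply/asboolP; exact: RaagRefl.
  by apply/asboolP/asboolP; exact: RaagSym.
by move=> /asboolP w12 /asboolP w23; apply/asboolP; exact: RaagTrans w12 w23.
Qed.

Canonical raag_equiv := EquivRelPack raag_relb_equiv.

Definition raag : Type := {eq_quot raag_relb}.

HB.instance Definition _ := Choice.on raag.

Definition raag_class (w : word) : raag := \pi_({eq_quot raag_relb}) w.

Lemma raag_classP w1 w2 : raag_class w1 = raag_class w2 <-> raag_rel w1 w2.
Proof.
split=> [/eqP|w12]; first by rewrite eqmodE => /asboolP.
by apply/eqP; rewrite eqmodE; apply/asboolP.
Qed.

Lemma raag_class_repr (g : raag) : raag_class (repr g) = g.
Proof. exact: reprK. Qed.

Lemma raag_rel_repr w : raag_rel (repr (raag_class w)) w.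
Proof. by apply/raag_classP; rewrite raag_class_repr. Qed.

Definition word_inv (w : word) : word := rev [seq (l.1, ~~ l.2) | l <- w].

Lemma word_invK : involutive word_inv.
Proof.
move=> w; rewrite /word_inv map_rev revK -map_comp -[RHS]map_id.
by apply: eq_map => -[v b] /=; rewrite negbK.
Qed.

Lemma raag_rel_invr w : raag_rel (w ++ word_inv w) [::].
Proof.
elim: w => [|[v b] w IH]; first exact: RaagRefl.
rewrite /word_inv /= rev_cons -cats1 -/(word_inv w) -cat1s catA -catA.
rewrite [w ++ _]catA.
apply: RaagTrans (RaagInv v b); rewrite -[[:: _; _]]/([:: (v, b)] ++ [:: (v, ~~ b)]).
apply: RaagCat; first exact: RaagRefl.
rewrite -[X in raag_rel _ X]cat0s; apply: RaagCat => //; exact: RaagRefl.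
Qed.

Lemma raag_rel_invl w : raag_rel (word_inv w ++ w) [::].
Proof. by rewrite -{2}[w]word_invK; exact: raag_rel_invr. Qed.

Definition raag_one : raag := raag_class [::].
Definition raag_mul (g h : raag) : raag := raag_class (repr g ++ repr h).
Definition raag_inv (g : raag) : raag := raag_class (word_inv (repr g)).

Lemma raag_mul_class w1 w2 :
  raag_mul (raag_class w1) (raag_class w2) = raag_class (w1 ++ w2).
Proof. by apply/raag_classP; apply: RaagCat; exact: raag_rel_repr. Qed.

Lemma raag_mulA : associative raag_mul.
Proof.
move=> g h k; rewrite -[g]raag_class_repr -[h]raag_class_repr -[k]raag_class_repr.
by rewrite !raag_mul_class catA.
Qed.

Lemma raag_mul1 : left_id raag_one raag_mul.
Proof. by move=> g; rewrite -[g]raag_class_repr raag_mul_class. Qed.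

Lemma raag_mulr1 : right_id raag_one raag_mul.
Proof. by move=> g; rewrite -[g]raag_class_repr raag_mul_class cats0. Qed.

Lemma raag_mulV : left_inverse raag_one raag_inv raag_mul.
Proof.
move=> g; rewrite -{2}[g]raag_class_repr raag_mul_class.
by apply/raag_classP; exact: raag_rel_invl.
Qed.

Lemma raag_mulrV : right_inverse raag_one raag_inv raag_mul.
Proof.
move=> g; rewrite -{1}[g]raag_class_repr raag_mul_class.
by apply/raag_classP; exact: raag_rel_invr.
Qed.

HB.instance Definition _ := isGroup.Build raag
  raag_mulA raag_mul1 raag_mulr1 raag_mulV raag_mulrV.

Local Open Scope group_scope.

Definition gen (v : V) : raag := raag_class [:: (v, true)].

Lemma raag_classM w1 w2 : raag_class (w1 ++ w2) = raag_class w1 * raag_class w2.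
Proof. by rewrite -raag_mul_class. Qed.

Lemma raag_classV v : raag_class [:: (v, false)] = (gen v)^-1.
Proof.
apply/esym/mulg1_eq; rewrite -raag_classM.
by apply/raag_classP; exact: (RaagInv v true).
Qed.

Lemma gen_comm v w : E v w -> gen v * gen w = gen w * gen v.
Proof.
by move=> vw; rewrite -!raag_classM; apply/raag_classP; exact: RaagComm.
Qed.

Lemma raag_ind (P : raag -> Prop) :
  P 1 -> (forall g v, P g -> P (gen v * g)) ->
  (forall g v, P g -> P ((gen v)^-1 * g)) -> forall g, P g.
Proof.
move=> P1 PM PV g; rewrite -[g]raag_class_repr.
elim: (repr g) => [|[v b] w IH]; first exact: P1.
by rewrite -cat1s raag_classM; case: b; [exact: PM | rewrite raag_classV; exact: PV].
Qed.

Lemma raag_universal (H : groupType) (f : V -> H) :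
  (forall v w, E v w -> f v * f w = f w * f v) ->
  exists! phi : raag -> H, {morph phi : g h / g * h} /\ forall v, phi (gen v) = f v.
Proof.
move=> fC.
pose lift1 (l : V * bool) := if l.2 then f l.1 else (f l.1)^-1.
pose liftw w := foldr (fun l h => lift1 l * h) 1 w.
have liftD w1 w2 : liftw (w1 ++ w2) = liftw w1 * liftw w2.
  by elim: w1 => [|l w1 IH] /=; rewrite ?mul1g // IH mulgA.
have liftP w1 w2 : raag_rel w1 w2 -> liftw w1 = liftw w2.
  elim=> // {w1 w2} [w1 w2 w3 _ -> _ -> //|w1 w2 w1' w2' _ e1 _ e2|v b|v w vw].
  - by rewrite !liftD e1 e2.
  - by case: b; rewrite /= /lift1 /= mulg1 ?mulgV ?mulVg.
  - by rewrite /= /lift1 /= !mulg1 fC.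
pose phi (g : raag) := liftw (repr g).
have phiE w : phi (raag_class w) = liftw w by apply: liftP; exact: raag_rel_repr.
have phiM : {morph phi : g h / g * h}.
  move=> g h; rewrite -[g]raag_class_repr -[h]raag_class_repr -raag_classM.
  by rewrite !phiE liftD.
have phig v : phi (gen v) = f v by rewrite phiE /= /lift1 /= mulg1.
exists phi; split => // psi [psiM psig]; apply/funext.
have psi1 : psi 1 = 1 by apply: (mulgI (psi 1)); rewrite -psiM !mulg1.
have psiV g : psi g^-1 = (psi g)^-1 by apply/esym/mulg1_eq; rewrite -psiM mulgV.
apply: raag_ind => [|g v IH|g v IH]; first by rewrite psi1; exact: (phiE [::]).
  by rewrite phiM psiM phig psig IH.
rewrite phiM psiM psiV psig IH; congr (_ * _).
by rewrite -raag_classV phiE /= /lift1 /= mulg1.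
Qed.

End RAAG.

(* Only the 1-skeleton of the cube complex is needed: its vertices are the
   elements of the group and it is the Cayley graph with respect to the
   standard generators; halfspaces are sets of vertices. *)

Section Halfspaces.
Variables (V : finType) (E : rel V).
Local Notation Gamma := (raag E).
Local Open Scope group_scope.

Definition adj : rel Gamma :=
  fun g h => [exists v : V, (h == g * gen E v) || (g == h * gen E v)].

Definition joined_by (g h : Gamma) (n : nat) : Prop :=
  exists p : seq Gamma, [/\ path adj g p, last g p = h & size p = n].

Lemma adj_sym : symmetric adj.
Proof. by move=> g h; apply: eq_existsb => v; rewrite orbC. Qed.

Lemma adj_connected (g h : Gamma) : exists n, `[< joined_by g h n >].
Proof.
rewrite -[h](mulVKg g); move: (g^-1 * h) => {h} h.
elim/raag_ind: h g => [|h v IH|h v IH] g.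
- by exists 0%N; apply/asboolP; exists [::]; rewrite mulg1.
- have [n /asboolP[p [gp pl pn]]] := IH (g * gen E v).
  exists n.+1; apply/asboolP; exists (g * gen E v :: p).
  rewrite /= pn; split=> //; last by rewrite pl mulgA.
  by rewrite gp andbT; apply/existsP; exists v; rewrite eqxx.
- have [n /asboolP[p [gp pl pn]]] := IH (g * (gen E v)^-1).
  exists n.+1; apply/asboolP; exists (g * (gen E v)^-1 :: p).
  rewrite /= pn; split=> //; last by rewrite pl mulgA.
  by rewrite gp andbT; apply/existsP; exists v; rewrite mulgVK eqxx orbT.
Qed.

Definition dist (g h : Gamma) : nat := ex_minn (adj_connected g h).

Definition side (a b : Gamma) : set Gamma := [set c | (dist c a < dist c b)%N].

Definition halfspace (h : set Gamma) : Prop :=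
  exists a b, adj a b /\ h = side a b.

(* lambda(h) = v, as a relation: all edges dual to h have the same label. *)
Definition has_label (h : set Gamma) (v : V) : Prop :=
  exists g, h = side g (g * gen E v) \/ h = side (g * gen E v) g.

Definition interval (x y : Gamma) : set (set Gamma) :=
  [set h | [/\ halfspace h, h y & ~ h x]].

Definition tightly_nested (h k : set Gamma) : Prop :=
  [/\ k `<=` h, h <> k &
      ~ exists h', [/\ halfspace h', h' <> h, h' <> k, k `<=` h' & h' `<=` h]].

(* The sequence [:: h_1; ...; h_l]. *)
Definition segment (s : seq (set Gamma)) : Prop :=
  [/\ (0 < size s)%N,
      (forall h, h \in s -> halfspace h) &
      (forall i, (i.+1 < size s)%N ->
         tightly_nested (nth set0 s i) (nth set0 s i.+1))].

Definition translate (g : Gamma) (s : seq (set Gamma)) : seq (set Gamma) :=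
  [seq [set g * c | c in (h : set Gamma)] | h <- s].

Definition translates_in (s : seq (set Gamma)) (x y : Gamma) :
    set (seq (set Gamma)) :=
  [set t | (exists g, t = translate g s) /\ forall h, h \in t -> interval x y h].

Variable R : realType.

(* Intervals are finite sets of halfspaces, so [fset_set], which is empty on
   infinite sets, is only used on finite sets here. *)
Definition median_count (s : seq (set Gamma)) (x y : Gamma) : R :=
  (#|` fset_set (translates_in s x y)|%:R - #|` fset_set (translates_in s y x)|%:R)%R.

Definition median_qm (s : seq (set Gamma)) (x : Gamma) : Gamma -> R :=
  fun g => median_count s x (g * x).

End Halfspaces.

Arguments segment {V E} s.
Arguments has_label {V E} h v.
Arguments median_qm {V E} R s x.

Definition hat (R : realType) (G : groupType) (f : G -> R) : cochain R G 1 :=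
  fun g => f ((g ord0)^-1 * g ord_max)%g.

(* [is_qm_class f phi]: the coboundary of [hat f] is a bounded cocycle, as is
   the case when f is a quasimorphism, and phi is its class. *)
Definition is_qm_class (R : realType) (G : groupType) (f : G -> R)
    (phi : Hb R G 2) : Prop :=
  exists2 z : bZ R G 2, bZ_val z = delta (hat f) & phi = bclass z.

Definition median_span (R : realType) (V : finType) (E : rel V) (x : raag E)
    (F : {set V}) : set (Hb R (raag E) 2) :=
  lspan [set phi | exists s : seq (set (raag E)),
    [/\ segment s,
        exists2 v, v \in F & has_label (head set0 s) v,
        exists2 v, v \in F & has_label (last set0 s) v &
        is_qm_class (median_qm R s x) phi]].

Arguments median_span R {V E} x F.

(* Main.v *)
(* A word path in the Cayley graph crosses a sequence of walls with label in F. Encoding a wall with label v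
   as a coset of the subgroup generated by the link of v, and using that F is independent, the freely
   reduced sequence P(x, y) of these crossings depends only on the endpoints x and y, so that
   P(x, z) is the free product of P(x, y) and P(y, z); along a geodesic no reduction takes place, whence P(x, y)
   lists exactly the halfspaces of [x, y] with label in F, in nested order. A segment s whose ends have labels
   in F is thus counted by a function of the subwords (windows) of P(x, y): its median quasimorphism is a
   counting quasimorphism of a free group pulled back along the free-group valued cocycle P.

   For such f and g, the 2-cochain eta(x0, x1, x2) = "integral of f(x0, .) dg along P(x1, x2)" satisfies
   eta(x0, x1, x2) + eta(x0, x2, x3) - eta(x0, x1, x3) = f(x0, m) dg(x1, x2, x3) + O(1), where m is the center of
   the tripod x1, x2, x3 and dg is the coboundary of g, because off the center the contributions cancel. Applied with
   base points x0 and x1, this shows that the cochain f U dg differs from a coboundary by a bounded cochain,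
   which is then a bounded primitive of df U dg.

   For the dimension, let a, b be distinct in F. The segment spelled by a b^j a^-1 occurs n times
   in (a^i b^i a^-i b^-i)^n if i = j and never if i <> j, its inverse never occurs, and homomorphisms to R vanish on
   commutators; so the corresponding classes are linearly independent. *)
Require Import Defs.
From HB Require Import structures.
From mathcomp Require Import all_boot all_order all_algebra finmap.
From mathcomp Require Import boolp classical_sets cardinality reals.
From mathcomp Require Import zify ring lra.

Set Implicit Arguments.
Unset Strict Implicit.
Unset Printing Implicit Defensive.

Import Order.TTheory GRing.Theory Num.Theory.
Local Open Scope classical_set_scope.
Local Open Scope ring_scope.

(** * Free reduction *)

Section FreeReduction.
Variables (L : eqType) (inv : L -> L).
Hypothesis invK : involutive inv.
Implicit Types (a b : L) (u v w : seq L).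

Definition cancel_cons a u :=
  if u is b :: u' then if b == inv a then u' else a :: u else [:: a].
Definition red w := foldr cancel_cons [::] w.
Definition reduced w := sorted (fun a b => b != inv a) w.
Definition winv w := rev (map inv w).
Arguments reduced : simpl never.

Lemma winvK : involutive winv.
Proof.
move=> w; rewrite /winv map_rev revK -map_comp -[RHS]map_id.
by apply: eq_map => a /=; rewrite invK.
Qed.

Lemma winv_cat u v : winv (u ++ v) = winv v ++ winv u.
Proof. by rewrite /winv map_cat rev_cat. Qed.

Lemma winv_cons a u : winv (a :: u) = rcons (winv u) (inv a).
Proof. by rewrite /winv /= rev_cons. Qed.

Lemma winv_rcons u a : winv (rcons u a) = inv a :: winv u.
Proof. by rewrite /winv map_rcons rev_rcons. Qed.

Lemma size_winv u : size (winv u) = size u.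
Proof. by rewrite size_rev size_map. Qed.

Lemma reduced_cons a u :
  reduced (a :: u) = (ohead u != Some (inv a)) && reduced u.
Proof. by case: u. Qed.


Lemma reduced_cat u v : reduced (u ++ v) -> reduced u /\ reduced v.
Proof.
elim: u => [//|a u IH] /=; rewrite !reduced_cons => /andP[ha /IH[hu hv]].
by split=> //; rewrite hu andbT; case: u ha {IH hu}.
Qed.

Lemma reduced_cat_rcons u a v :
  reduced (rcons u a ++ v) =
  reduced (rcons u a) && reduced v && (ohead v != Some (inv a)).
Proof.
elim: u => [|b u IH]; first by rewrite cat_cons !reduced_cons /= andbC.
rewrite !rcons_cons cat_cons !reduced_cons IH !andbA; congr (_ && _ && _ && _).
by case: u {IH}.
Qed.

Lemma reduced_winv u : reduced (winv u) = reduced u.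
Proof.
rewrite /reduced /winv rev_sorted sorted_map.
case: u => [//|c u]; apply: eq_path => a b /=.
by rewrite invK eq_sym.
Qed.

Lemma reduced_cat_winv u v :
  reduced u -> reduced v -> ohead v != ohead u -> reduced (winv u ++ v).
Proof.
case: u => [//|a u] ru rv h.
rewrite winv_cons reduced_cat_rcons -winv_cons reduced_winv ru rv /=.
by rewrite invK.
Qed.

Lemma reduced_cancel_cons a u : reduced u -> reduced (cancel_cons a u).
Proof.
case: u => [//|b u] r /=; case: eqP => [_|/eqP ne]; last first.
  by rewrite reduced_cons /= r andbT; apply: contra ne => /eqP[->].
by move: r; rewrite reduced_cons => /andP[].
Qed.

Lemma reduced_red w : reduced (red w).
Proof. by elim: w => [//|a w IH]; exact: reduced_cancel_cons. Qed.

Lemma red_id w : reduced w -> red w = w.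
Proof.
elim: w => [//|a w IH]; rewrite reduced_cons /= => /andP[ne /IH ->].
by case: w ne {IH} => [//|b w] /=; rewrite (inj_eq (@Some_inj _)) => /negbTE ->.
Qed.

(** On reduced words a letter and its inverse act as mutually inverse maps. Reducedness matters when
    [inv a] cancels the head of [u]: the next letter is then not [inv a], so [a] is simply put
    back. *)
Lemma cancel_consK a u : reduced u -> cancel_cons a (cancel_cons (inv a) u) = u.
Proof.
case: u => [|b u]; first by rewrite /= eqxx.
rewrite /cancel_cons invK; case: eqP => [->|_] r; last by rewrite eqxx.
by move: r; rewrite reduced_cons; case: u => [//|c u] /= /andP[/negbTE + _];
  rewrite (inj_eq (@Some_inj _)) => ->.
Qed.

Lemma red_catr u v : red (u ++ red v) = red (u ++ v).
Proof. by rewrite /red !foldr_cat [X in foldr _ X _](red_id (reduced_red v)). Qed.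

Lemma red_catl u v : red (red u ++ v) = red (u ++ v).
Proof.
elim: u => [//|a u IH] /=.
rewrite -IH; case: (red u) => [//|b w] /=; case: eqP => [->|//].
by rewrite cancel_consK // reduced_red.
Qed.

Lemma red_cat_eq u u' v v' :
  red u = red u' -> red v = red v' -> red (u ++ v) = red (u' ++ v').
Proof. by move=> hu hv; rewrite -red_catl -red_catr hu hv red_catr red_catl. Qed.

Lemma red_winvr u : red (u ++ winv u) = [::].
Proof.
elim: u => [//|a u IH].
rewrite winv_cons -cats1 catA cat_cons /=.
by rewrite -red_catl IH /= eqxx.
Qed.

Lemma red_winvl u : red (winv u ++ u) = [::].
Proof. by rewrite -{2}[u]winvK red_winvr. Qed.

Lemma red_winv_unique u v : red (u ++ v) = [::] -> red v = winv (red u).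
Proof.
move=> h; have : red (winv u ++ u ++ v) = red (winv u).
  by rewrite (red_cat_eq (erefl (red (winv u))) (v' := [::])) ?h ?cats0.
rewrite catA (red_cat_eq (u' := [::]) (v' := v)) ?red_winvl //= => ->.
rewrite -[RHS]red_id ?reduced_winv ?reduced_red //.
have : red (winv (red u) ++ u ++ winv u) = red (winv u).
  by rewrite catA (red_cat_eq (u' := [::]) (v' := winv u)) // -red_catr red_winvl.
by rewrite (red_cat_eq (erefl (red (winv (red u)))) (v' := [::])) ?cats0 // red_winvr.
Qed.

(** The words [u], [v] and their product are the sides of a tripod in a tree; [A], [B], [C] are read
    from its corners to its centre, and [B] is the piece that cancels. *)
Lemma red_tripod u v : reduced u -> reduced v ->
  exists A B C, [/\ u = A ++ winv B, v = B ++ winv C & red (u ++ v) = A ++ winv C].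
Proof.
elim/last_ind: u v => [|u a IH] v ru rv.
  by exists [::], [::], (winv v); rewrite winvK /= red_id.
have [] := boolP (ohead v == Some (inv a)); last first.
  move=> ne; exists (rcons u a), [::], (winv v); rewrite winvK cats0; split=> //.
  by rewrite red_id // reduced_cat_rcons ru rv.
case: v rv => [//|b v] rv /= /eqP[bE]; subst b.
have [ru' _] : reduced u /\ reduced [:: a] by apply: reduced_cat; rewrite cats1.
have rv' : reduced v by move: rv; rewrite reduced_cons => /andP[].
have [A [B [C [uE vE rE]]]] := IH v ru' rv'.
(* The last letter of [u] cancels the first letter of [v], so the cancelled leg grows by one letter
   at its outer end. *)
exists A, (inv a :: B), C; rewrite winv_cons invK; split.
- by rewrite uE -rcons_cat.
- by rewrite vE.
rewrite -rE cat_rcons -[a :: _](cat1s a) -[inv a :: v]cat1s.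
rewrite (catA [:: a]); apply: red_cat_eq => //.
by apply: (red_cat_eq (u' := [::])) => //=; rewrite eqxx.
Qed.

End FreeReduction.

Arguments reduced {L} inv w : simpl never.

Lemma red_map (L : eqType) (inv : L -> L) (f : L -> L) (u : seq L) :
  injective f -> {morph f : a / inv a} -> red inv (map f u) = map f (red inv u).
Proof.
move=> fI fM; elim: u => [//|a u IH] /=; rewrite IH.
by case: (red inv u) => [//|b w] /=; rewrite -fM (inj_eq fI); case: eqP.
Qed.

(** * Counting quasimorphisms on a free group *)

Section TriangularSums.
Variable R : realFieldType.
Implicit Types (Phi : nat -> nat -> R) (n p m : nat).

(** The pairs $i<j\le n$ are the end positions of the nonempty windows of a word of length $n$;
    [cross] keeps those with $i<p<j$, which straddle position $p$. *)
Definition tri n Phi : R := \sum_(0 <= i < n) \sum_(i.+1 <= j < n.+1) Phi i j.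
Definition cross p n Phi : R := \sum_(0 <= i < p) \sum_(p.+1 <= j < n.+1) Phi i j.

Lemma eq_tri n Phi Phi' :
  (forall i j, (i < j <= n)%N -> Phi i j = Phi' i j) -> tri n Phi = tri n Phi'.
Proof.
move=> h; apply: eq_big_nat => i _; apply: eq_big_nat => j /andP[ij jn].
by apply: h; rewrite ij.
Qed.

Lemma tri_cat p m Phi :
  tri (p + m) Phi =
  tri p Phi + cross p (p + m) Phi + tri m (fun i j => Phi (p + i)%N (p + j)%N).
Proof.
rewrite /tri (big_cat_nat (n := p)) ?leq_addr //=; congr (_ + _).
  rewrite -big_split /=; apply: eq_big_nat => i /andP[_ ip].
  by rewrite (big_cat_nat (n := p.+1)) //=; lia.
rewrite -{1}[p]add0n big_addn addKn; apply: eq_big_nat => i _.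
rewrite -addSn big_addn -addnS addKn [(i + p)%N]addnC; apply: eq_bigr => j _.
by rewrite [(j + p)%N]addnC.
Qed.

Lemma tri_ord n Phi :
  tri n Phi = \sum_(i < n.+1) \sum_(j < n.+1 | (i < j)%N) Phi i j.
Proof.
rewrite big_ord_recr /= [X in _ + X]big1 => [|j]; last first.
  by move=> h; have := ltn_ord j; lia.
rewrite addr0 /tri big_mkord; apply: eq_bigr => i _.
by rewrite (big_nat_widenl _ 0) // big_mkord.
Qed.

Lemma tri_rev n Phi : tri n Phi = tri n (fun i j => Phi (n - j)%N (n - i)%N).
Proof.
rewrite !tri_ord (reindex_inj rev_ord_inj) /=.
under eq_bigr do rewrite (reindex_inj rev_ord_inj) /=.
rewrite (exchange_big_dep xpredT) //=.
apply: eq_bigr => i _; apply: eq_big => [j|j _]; last by rewrite !subSS.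
by have := ltn_ord i; have := ltn_ord j; lia.
Qed.

Lemma tri_opp n Phi : tri n (fun i j => - Phi i j) = - tri n Phi.
Proof. by rewrite /tri -sumrN; apply: eq_bigr => i _; rewrite sumrN. Qed.

Lemma tri_add n Phi Phi' :
  tri n (fun i j => Phi i j + Phi' i j) = tri n Phi + tri n Phi'.
Proof. by rewrite /tri -big_split /=; apply: eq_bigr => i _; rewrite big_split. Qed.

Lemma tri_scale n (a : R) Phi : tri n (fun i j => a * Phi i j) = a * tri n Phi.
Proof. by rewrite /tri mulr_sumr; apply: eq_bigr => i _; rewrite mulr_sumr. Qed.

Lemma ler_norm_tri n Phi (K : R) :
  (forall i j, (i < j <= n)%N -> `|Phi i j| <= K) -> 0 <= K ->
  `|tri n Phi| <= K * n%:R ^+ 2.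
Proof.
move=> h K0; rewrite /tri; apply: le_trans (ler_norm_sum _ _ _) _.
rewrite big_mkord (@le_trans _ _ (\sum_(i < n) (K * n%:R))) //; last first.
  by rewrite sumr_const card_ord -mulr_natr; lra.
apply: ler_sum => i _; apply: le_trans (ler_norm_sum _ _ _) _.
rewrite big_nat (@le_trans _ _ (\sum_(i.+1 <= j < n.+1) K)) //.
  by rewrite [leRHS]big_nat; apply: ler_sum => j /andP[ij jn]; rewrite h // ij.
rewrite big_const_nat iter_addr_0 -[leLHS]mulr_natr ler_wpM2l // ler_nat.
by lia.
Qed.

(** Only pairs with $p-D\le i<p<j\le p+D$ contribute, hence at most $D$ values of each index; the
    bound is independent of the lengths [p] and [m]. *)
Lemma ler_norm_cross p m D Phi (K : R) : 0 <= K ->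
  (forall i j, (i < p)%N -> (p < j <= p + m)%N -> (j <= i + D)%N -> `|Phi i j| <= K) ->
  (forall i j, (i < p)%N -> (p < j <= p + m)%N -> (i + D < j)%N -> Phi i j = 0) ->
  `|cross p (p + m) Phi| <= K * D%:R ^+ 2.
Proof.
move=> K0 h h0; apply: le_trans (ler_norm_sum _ _ _) _.
have inner i : (i < p)%N ->
    `|\sum_(p.+1 <= j < (p + m).+1) Phi i j| <= (p <= i + D)%:R * (K * D%:R).
  move=> ip; apply: le_trans (ler_norm_sum _ _ _) _.
  rewrite (big_cat_nat (n := minn (p + m).+1 (p + D).+1)) /=; [|lia|lia].
  rewrite [X in _ + X]big_nat [X in _ + X]big1 ?addr0; last first.
    by move=> j hj; rewrite h0 ?normr0 //; lia.
  case: leqP => [pD|pD]; rewrite ?mul1r ?mul0r; last first.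
    by rewrite big_nat big1 // => j hj; rewrite h0 ?normr0 //; lia.
  rewrite big_nat (@le_trans _ _ (\sum_(p.+1 <= j < minn (p + m).+1 (p + D).+1) K)) //.
    rewrite [leRHS]big_nat; apply: ler_sum => j hj.
    case: (leqP j (i + D)) => jD; first by apply: h => //; lia.
    by rewrite h0 ?normr0 //; lia.
  rewrite big_const_nat iter_addr_0 -[leLHS]mulr_natr ler_wpM2l // ler_nat; lia.
rewrite big_nat (@le_trans _ _ (\sum_(0 <= i < p) (p <= i + D)%:R * (K * D%:R))) //.
  by rewrite [leRHS]big_nat; apply: ler_sum => i /andP[_ ip]; exact: inner.
rewrite -mulr_suml (_ : K * _ ^+ 2 = D%:R * (K * D%:R)); last by ring.
rewrite ler_wpM2r ?mulr_ge0 //.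
rewrite (big_cat_nat (n := (p - D)%N)) //=; last by lia.
rewrite big_nat big1 ?add0r; last by move=> i hi; case: leqP => //; lia.
rewrite (@le_trans _ _ (\sum_(p - D <= i < p) 1)) //.
  by apply: ler_sum => i _; rewrite lern1 leq_b1.
by rewrite big_const_nat iter_addr_0 ler_nat; lia.
Qed.

End TriangularSums.

(** * Counting functions of a bounded antisymmetric weight on short words *)

Section Counting.
Variables (L : eqType) (inv : L -> L).
Hypothesis invK : involutive inv.
Variables (R : realFieldType) (phi : seq L -> R) (D : nat) (M : R).
Hypothesis phi_winv : forall w, phi (winv inv w) = - phi w.
Hypothesis phi_long : forall w, (D < size w)%N -> phi w = 0.
Hypothesis phi_bd : forall w, `|phi w| <= M.
Implicit Types u v w q r : seq L.
Local Notation winv := (winv inv).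
Local Notation red := (red inv).
Local Notation reduced := (reduced inv).

Definition window i j u := drop i (take j u).

Lemma size_window i j u : (j <= size u)%N -> size (window i j u) = (j - i)%N.
Proof. by move=> ju; rewrite size_drop size_takel. Qed.

Lemma window_catl i j u v : (j <= size u)%N -> window i j (u ++ v) = window i j u.
Proof. by move=> ju; rewrite /window takel_cat. Qed.

Lemma take_catr i u v : take (size u + i) (u ++ v) = u ++ take i v.
Proof. by rewrite take_cat ltnNge leq_addr /= addKn. Qed.

Lemma window_catr i j u v :
  window (size u + i) (size u + j) (u ++ v) = window i j v.
Proof. by rewrite /window take_catr drop_cat ltnNge leq_addr /= addKn. Qed.

Lemma take_winv i u : (i <= size u)%N -> take i (winv u) = winv (drop (size u - i) u).
Proof. by move=> iu; rewrite /winv take_rev size_map map_drop. Qed.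

Lemma window_winv i j u : (i < j <= size u)%N ->
  window i j (winv u) = winv (window (size u - j) (size u - i) u).
Proof.
move=> /andP[ij ju]; rewrite /window take_winv // /winv drop_rev.
rewrite size_map size_drop map_drop map_drop map_take take_drop.
by congr (rev (drop _ (take _ _))); lia.
Qed.

Definition wsum u := tri (size u) (fun i j => phi (window i j u)).
Definition wcross u v :=
  cross (size u) (size u + size v) (fun i j => phi (window i j (u ++ v))).

Lemma wsum_cat u v : wsum (u ++ v) = wsum u + wcross u v + wsum v.
Proof.
rewrite /wsum size_cat tri_cat; congr (_ + _ + _); apply: eq_tri => i j /andP[ij jn].
  by rewrite window_catl.
by rewrite window_catr.
Qed.

Lemma wsum_winv u : wsum (winv u) = - wsum u.
Proof.
rewrite /wsum size_winv tri_rev -tri_opp; apply: eq_tri => i j /andP[ij jn].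
by rewrite window_winv ?phi_winv; [rewrite !subKn //|]; lia.
Qed.

Lemma M_ge0 : 0 <= M.
Proof. exact: le_trans (phi_bd [::]). Qed.
Hint Resolve M_ge0 : core.

Lemma wcross_bound u v : `|wcross u v| <= M * D%:R ^+ 2.
Proof.
apply: ler_norm_cross => // i j iu /andP[uj juv] ij; rewrite phi_long //.
by rewrite size_window ?size_cat //; lia.
Qed.

Lemma wsum_bound u : `|wsum u| <= M * (size u)%:R ^+ 2.
Proof. exact: ler_norm_tri. Qed.

Definition count_qm u := wsum (red u).

Lemma count_qm_red u : count_qm (red u) = count_qm u.
Proof. by rewrite /count_qm (red_id (reduced_red _ _)). Qed.

(** On the tripod spanned by [u] and [v] the sums along the three legs cancel by antisymmetry. What
    remains are three sums over windows straddling the centre. *)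
Lemma count_qm_defect u v :
  `|count_qm (u ++ v) - count_qm u - count_qm v| <= 3 * (M * D%:R ^+ 2).
Proof.
have [A [B [C [uE vE uvE]]]] := red_tripod invK (reduced_red inv u) (reduced_red inv v).
rewrite /count_qm -red_catl // -red_catr // uvE uE vE !wsum_cat !wsum_winv.
have := wcross_bound A (winv C); have := wcross_bound A (winv B).
have := wcross_bound B (winv C); rewrite !ler_norml; lra.
Qed.

(** Serves as the hypothesis [f_bound] below: along a single window, of length at most [D], a
    counting quasimorphism changes by a bounded amount. *)
Lemma count_qm_bound u : (size u <= D)%N -> `|count_qm u| <= M * D%:R ^+ 2.
Proof.
move=> uD; apply: le_trans (wsum_bound _) _.
rewrite ler_wpM2l // lerXn2r ?nnegrE ?ler0n // ler_nat; apply: leq_trans uD.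
elim: u => [//|a u IH] /=; case: (red u) IH => [//|b w] /=.
by case: eqP => _ /=; lia.
Qed.

(* The discrete integral of f(q, .) against the measure given by the windows of r; evaluating f at
   both ends of each window makes it exactly antisymmetric under reversal of r. *)
Definition integral (f : seq L -> R) q r :=
  tri (size r) (fun i j => (f (q ++ take i r) + f (q ++ take j r)) * phi (window i j r)).

Section Integral.
Variables (f : seq L -> R) (Cf Kf : R).
Hypothesis f_red : forall u, f (red u) = f u.
Hypothesis f_defect : forall u v, `|f (u ++ v) - f u - f v| <= Cf.
Hypothesis f_bound : forall u, (size u <= D)%N -> `|f u| <= Kf.
Local Notation eta := (integral f).

Lemma integral_red q q' r : red q = red q' -> eta q r = eta q' r.
Proof.
move=> qq'; apply: eq_tri => i j _.
by rewrite -!(f_red (q ++ _)) -!(f_red (q' ++ _)) !(red_cat_eq invK qq' (erefl _)).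
Qed.

Definition icross q u v := cross (size u) (size u + size v) (fun i j =>
  (f (q ++ take i (u ++ v)) + f (q ++ take j (u ++ v))) * phi (window i j (u ++ v))).

Lemma integral_cat q u v : eta q (u ++ v) = eta q u + icross q u v + eta (q ++ u) v.
Proof.
rewrite /integral size_cat tri_cat; congr (_ + _ + _); apply: eq_tri => i j /andP[ij jn].
  by rewrite window_catl // !takel_cat //; lia.
by rewrite window_catr !take_catr !catA.
Qed.

Lemma integral_winv q r : eta q (winv r) = - eta (q ++ winv r) r.
Proof.
rewrite /integral size_winv tri_rev -tri_opp; apply: eq_tri => i j /andP[ij jn].
(* The points passed by [winv r] from [q] are those passed by [r] from [q ++ winv r], in the
   opposite order: [winv (take k r) ++ take k r] cancels. *)
have E k : (k <= size r)%N -> f (q ++ take (size r - k) (winv r)) = f ((q ++ winv r) ++ take k r).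
  move=> kr; rewrite take_winv ?leq_subr // subKn // -f_red -[RHS]f_red -catA.
  congr f; apply: red_cat_eq => //; rewrite -{2}(cat_take_drop k r) winv_cat -catA.
  by rewrite -[LHS]cats0 (red_cat_eq invK (erefl (red (winv (drop k r)))) (v' := [::])) ?cats0 ?red_winvl.
have jn' : (i <= size r)%N by lia.
rewrite window_winv ?phi_winv; last by lia.
by rewrite !subKn // !E // addrC mulrN.
Qed.

(** A contributing window across the cut has length at most [D], so [f] at either of its ends is
    within [Cf + Kf] of its value at the cut. The factor 2 counts the two ends. *)
Lemma icross_bound q u v :
  `|icross q u v - 2 * f (q ++ u) * wcross u v| <= 2 * (Cf + Kf) * M * D%:R ^+ 2.
Proof.
have f0 : 0 <= Cf + Kf.
  rewrite addr_ge0 //; first exact: le_trans (f_defect [::] [::]).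
  exact: le_trans (f_bound (leq0n D : (size [::] <= D)%N)).
have near w z : (size z <= D)%N -> `|f (w ++ z) - f w| <= Cf + Kf.
  move=> zD; have := f_defect w z; have := f_bound zD; rewrite !ler_norml; lra.
rewrite /icross /wcross /cross mulr_sumr -sumrB.
under eq_bigr do rewrite mulr_sumr -sumrB.
apply: (@ler_norm_cross _ _ _ D (fun i j =>
  (f (q ++ take i (u ++ v)) + f (q ++ take j (u ++ v))) * phi (window i j (u ++ v))
   - 2 * f (q ++ u) * phi (window i j (u ++ v)))).
- by rewrite !mulr_ge0.
- move=> i j iu /andP[uj juv] ij; rewrite -mulrBl normrM ler_pM //.
  have h1 := near (q ++ take i u) (drop i u).
  have h2 := near (q ++ u) (take (j - size u) v).
  rewrite takel_cat 1?ltnW // -[j](@subnKC (size u)) 1?ltnW // take_catr.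
  rewrite -!catA cat_take_drop in h1 h2.
  have {}h1 : `|f (q ++ u) - f (q ++ take i u)| <= Cf + Kf by apply: h1; rewrite size_drop; lia.
  have {}h2 : `|f (q ++ u ++ take (j - size u) v) - f (q ++ u)| <= Cf + Kf.
    by apply: h2; rewrite size_take_min; lia.
  by move: h1 h2; rewrite !ler_norml; lra.
- move=> i j iu /andP[uj juv] ij; rewrite phi_long ?mulr0 ?subr0 //.
  by rewrite size_window ?size_cat //; lia.
Qed.

(* Up to a bounded error, the integral over the boundary of a tripod is concentrated at its
   center. *)
Lemma integral_tripod : exists K, forall a b, reduced a -> reduced b ->
  exists A, forall q,
  `|eta q a + eta (q ++ a) b - eta q (red (a ++ b))
    - 2 * f (q ++ A) * (wsum a + wsum b - wsum (red (a ++ b)))| <= K.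
Proof.
exists (3 * (2 * (Cf + Kf) * M * D%:R ^+ 2)) => a b ra rb.
have [A [B [C [-> -> ->]]]] := red_tripod invK ra rb; exists A => q.
(* Going out and back along the leg [B] leads back to the centre, so the base point of the last leg
   may be replaced by [q ++ A]. The three crossing errors then give the constant. *)
have rAB : red ((q ++ A ++ winv B) ++ B) = red (q ++ A).
  rewrite catA -catA; apply: (etrans (red_cat_eq invK (erefl _) (v' := [::]) _)).
    exact: red_winvl.
  by rewrite cats0.
have rAC : red (((q ++ A ++ winv B) ++ B) ++ winv C) = red ((q ++ A) ++ winv C).
  exact: red_cat_eq.
rewrite !integral_cat !integral_winv (integral_red _ rAC) -[(q ++ A) ++ winv B]catA.
have := icross_bound q A (winv B); have := icross_bound (q ++ A ++ winv B) B (winv C).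
have := icross_bound q A (winv C); rewrite -(f_red ((q ++ A ++ winv B) ++ B)) rAB f_red.
rewrite !wsum_cat !wsum_winv !ler_norml; lra.
Qed.

(** The tripod estimate is used with base [q] and with empty base, for the same centre [A]. The main
    terms combine to $-2(f(qA)-f(q)-f(A))\,dg$, a product of two bounded defects. *)
Lemma integral_cocycle : exists K, forall q a b, reduced a -> reduced b ->
  `|2 * f q * (wsum a + wsum b - wsum (red (a ++ b)))
    + (eta a b - eta (q ++ a) b + eta q (red (a ++ b)) - eta q a)
    - (eta [::] (red (a ++ b)) - eta [::] a)| <= K.
Proof.
have [K hK] := integral_tripod.
exists (2 * K + 2 * (Cf * (3 * (M * D%:R ^+ 2)))) => q a b ra rb.
have [A hA] := hK a b ra rb; have := hA q; have := hA [::]; rewrite !cat0s.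
set dg := wsum a + wsum b - _.
have dgb : `|dg| <= 3 * (M * D%:R ^+ 2).
  have := count_qm_defect a b; rewrite /count_qm !(red_id ra) !(red_id rb).
  by rewrite /dg !ler_norml; lra.
have : `|(f (q ++ A) - f q - f A) * dg| <= Cf * (3 * (M * D%:R ^+ 2)).
  by rewrite normrM ler_pM.
rewrite !ler_norml; lra.
Qed.

End Integral.
End Counting.

(** * Geodesics and halfspaces in a right-angled Artin group *)

Section Words.
Variables (V : finType) (E : rel V).
Hypothesis E_sym : symmetric E.
Local Notation Gamma := (raag E).
Local Notation cls := (raag_class E).
Local Open Scope group_scope.
Implicit Types (a b c g h q x y : Gamma) (l : V * bool) (u w p r : word V).

Definition flip l : V * bool := (l.1, ~~ l.2).

Definition letter_val l : Gamma := cls [:: l].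

Lemma flipK : involutive flip.
Proof. by case=> v b; rewrite /flip /= negbK. Qed.

Lemma letter_val_flip l : letter_val (flip l) = (letter_val l)^-1.
Proof.
apply/esym/mulg1_eq; rewrite -raag_classM; case: l => v s.
by apply/raag_classP; exact: RaagInv.
Qed.

Lemma raag_class_cons l w : cls (l :: w) = letter_val l * cls w.
Proof. by rewrite -raag_classM. Qed.

Lemma raag_class_rcons w l : cls (rcons w l) = cls w * letter_val l.
Proof. by rewrite -cats1 raag_classM. Qed.

Lemma raag_class_nil : cls [::] = 1.
Proof. by []. Qed.

Lemma raag_class_inv w : cls (word_inv w) = (cls w)^-1.
Proof.
by apply/esym/mulg1_eq; rewrite -raag_classM; apply/raag_classP; exact: raag_rel_invr.
Qed.

Lemma letter_val_comm l1 l2 : E l1.1 l2.1 ->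
  letter_val l1 * letter_val l2 = letter_val l2 * letter_val l1.
Proof.
have valE v s : letter_val (v, s) = if s then gen E v else (gen E v)^-1.
  by case: s => //; rewrite -(letter_val_flip (v, true)).
have commV g h : g * h = h * g -> g * h^-1 = h^-1 * g.
  by move=> gh; apply: (mulgI h); rewrite mulgA -gh mulgK mulVKg.
case: l1 l2 => [v s] [w d] /= /gen_comm H; rewrite !valE.
have H' := esym (commV _ _ (esym H)).
by case: s; case: d => //; exact: commV.
Qed.

Definition link v : set Gamma :=
  [set q | exists2 w, all (fun l => E v l.1) w & q = cls w].

Lemma link1 v : link v 1.
Proof. by exists [::]. Qed.

Lemma linkM v g h : link v g -> link v h -> link v (g * h).
Proof.
move=> [w wl ->] [z zl ->]; exists (w ++ z); first by rewrite all_cat wl.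
by rewrite raag_classM.
Qed.

Lemma linkV v g : link v g -> link v g^-1.
Proof.
move=> [w wl ->]; exists (word_inv w); last by rewrite raag_class_inv.
by rewrite /word_inv all_rev all_map.
Qed.

Lemma link_comm l q : link l.1 q -> q * letter_val l = letter_val l * q.
Proof.
move=> [w + ->]; elim: w => [|k w IH] /=; first by rewrite mul1g mulg1.
move=> /andP[lk wl]; rewrite raag_class_cons -mulgA IH // !mulgA; congr (_ * _).
by rewrite letter_val_comm // E_sym.
Qed.


(** * Geodesic words, distances and sides of edges *)

Definition geodesic w := forall w', cls w' = cls w -> (size w <= size w')%N.

Lemma geodesic_cat u w : geodesic (u ++ w) -> geodesic u /\ geodesic w.
Proof.
move=> uw; split=> z zE.
  have := uw (z ++ w); rewrite !raag_classM zE => /(_ erefl).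
  by rewrite !size_cat leq_add2r.
have := uw (u ++ z); rewrite !raag_classM zE => /(_ erefl).
by rewrite !size_cat leq_add2l.
Qed.

Lemma dist_le x y w : cls w = x^-1 * y -> (dist x y <= size w)%N.
Proof.
move=> wE; rewrite /dist; case: ex_minnP => n _; apply; apply/asboolP.
have -> : y = x * cls w by rewrite wE mulVKg.
elim: w x {wE} => [|l w IH] x; first by exists [::]; rewrite raag_class_nil mulg1.
have [p [xp pl pn]] := IH (x * letter_val l).
exists (x * letter_val l :: p); split; rewrite /= ?pn //; last first.
  by rewrite pl raag_class_cons mulgA.
rewrite xp andbT; apply/existsP; exists l.1.
case: l {IH xp pl} => v [] /=; first by rewrite eqxx.
by rewrite [letter_val _](letter_val_flip (v, true)) mulgVK eqxx orbT.
Qed.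

Lemma dist_word x y : exists2 w, cls w = x^-1 * y & size w = dist x y.
Proof.
rewrite /dist; case: ex_minnP => n /asboolP[p [xp <- <-]] _.
elim: p x xp => [|z p IH] x /=; first by exists [::] => //; rewrite mulVg.
move=> /andP[/existsP[v xz] /IH[w wE wn]].
have [l zE] : exists l, z = x * letter_val l.
  case/orP: xz => /eqP ->; first by exists (v, true).
  by exists (v, false); rewrite [letter_val _](letter_val_flip (v, true)) mulgK.
exists (l :: w); last by rewrite /= wn.
by rewrite raag_class_cons wE zE invgM -!mulgA mulVKg.
Qed.

Lemma dist_geodesic x y : exists w, [/\ cls w = x^-1 * y, size w = dist x y & geodesic w].
Proof.
have [w wE wn] := dist_word x y; exists w; split=> // z zE.
by rewrite wn dist_le // zE.
Qed.

(** The orientation of the edge is absorbed into the sign of the letter: from here on a halfspace is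
    the side of the end of a directed edge that starts at [a]. *)
Lemma halfspace_letter (h : set Gamma) :
  halfspace h -> exists a l, h = side (a * letter_val l) a.
Proof.
move=> [a [b [/existsP[v ab] ->]]]; case/orP: ab => /eqP ->.
  exists (a * gen E v), (v, false).
  by rewrite [letter_val _](letter_val_flip (v, true)) mulgK.
by exists b, (v, true).
Qed.

Lemma label_letter (h : set Gamma) v : has_label h v ->
  exists a l, l.1 = v /\ h = side (a * letter_val l) a.
Proof.
move=> [a [->|->]]; last by exists a, (v, true).
exists (a * gen E v), (v, false).
by rewrite [letter_val _](letter_val_flip (v, true)) mulgK.
Qed.

Lemma adj_letter a l : adj a (a * letter_val l).
Proof.
apply/existsP; exists l.1; case: l => v [] /=; first by rewrite eqxx.
by rewrite [letter_val _](letter_val_flip (v, true)) mulgVK eqxx orbT.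
Qed.

Lemma side_halfspace a l : halfspace (side (a * letter_val l) a).
Proof.
by exists (a * letter_val l), a; split=> //; rewrite adj_sym adj_letter.
Qed.

Lemma has_label_side a l : has_label (side (a * letter_val l) a) l.1.
Proof.
case: l => v [] /=; first by exists a; right.
exists (a * letter_val (v, false)); left.
by rewrite [letter_val _](letter_val_flip (v, true)) mulgVK.
Qed.

Lemma dist_mul g x y : dist (g * x) (g * y) = dist x y.
Proof.
apply/eqP; rewrite eqn_leq; apply/andP; split.
  have [w wE <-] := dist_word x y; apply: dist_le.
  by rewrite wE invgM mulgA mulgVK.
have [w wE <-] := dist_word (g * x) (g * y); apply: dist_le.
by rewrite wE invgM mulgA mulgVK.
Qed.

Lemma side_mul g a b : [set g * c | c in side a b] = side (g * a) (g * b).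
Proof.
apply/seteqP; split=> c; rewrite /side /=.
  by move=> [d h <-]; rewrite !dist_mul.
by move=> h; exists (g^-1 * c); rewrite ?mulVKg // -(dist_mul g) -(dist_mul g _ b) mulVKg.
Qed.

End Words.

(** * Crossings of hyperplanes *)

Section Crossings.
Variables (V : finType) (E : rel V).
Hypothesis E_sym : symmetric E.
Local Notation Gamma := (raag E).
Local Notation cls := (raag_class E).
Local Notation letter_val := (letter_val E).
Local Open Scope group_scope.
Implicit Types (a b c g h q x y : Gamma) (l : V * bool) (u w p r : word V).

Definition link_coset v a : set Gamma := [set c | link v (a^-1 * c)].

(* A hyperplane with label v is a coset of the subgroup generated by the link of v; the boolean is
   the direction in which it is crossed. *)
Definition crossing : Type := (V * set Gamma * bool)%type.
HB.instance Definition _ := Choice.on crossing.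
Implicit Types (e : crossing) (s t : seq crossing).

Definition reverse e : crossing := (e.1, ~~ e.2).
Definition shift g e : crossing := (e.1.1, [set g * c | c in e.1.2], e.2).
(** The coset is based at the tail of the positively oriented edge, which for an inverse letter is
    the end of the step. Both traversals of an edge thus name the same hyperplane and differ in the
    direction only. *)
Definition cross_at a l : crossing :=
  (l.1, link_coset l.1 (if l.2 then a else a * letter_val l), l.2).

Lemma reverseK : involutive reverse.
Proof. by case=> k s; rewrite /reverse /= negbK. Qed.

Lemma shift_inj g : injective (shift g).
Proof.
move=> [[v A] s] [[w B] d] [-> AB ->]; congr (_, _, _).

apply/seteqP; split=> c Ac.
  have : [set g * d | d in B] (g * c) by rewrite -AB; exists c.
  by move=> [d' Bd /mulgI <-].
have : [set g * d | d in A] (g * c) by rewrite AB; exists c.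
by move=> [d' Bd /mulgI <-].
Qed.

Lemma shift_reverse g : {morph shift g : e / reverse e}.
Proof. by []. Qed.

Lemma link_coset_eq v a b : link_coset v a = link_coset v b <-> link v (a^-1 * b).
Proof.
split=> [h|h].
  have : link_coset v b b by rewrite /link_coset /= mulVg; exact: link1.
  by rewrite -h.
apply/seteqP; split=> c; rewrite /link_coset /= => hc.
  rewrite -(mulVKg a c) mulgA -[b^-1 * a]invgK invgM invgK.
  exact: linkM (linkV h) hc.
by rewrite -(mulVKg b c) mulgA; exact: linkM.
Qed.

Lemma link_coset_shift v g a : [set g * c | c in link_coset v a] = link_coset v (g * a).
Proof.
apply/seteqP; split=> c; rewrite /link_coset /= ?invgM.
  by move=> [d h <-]; rewrite -mulgA mulKg.
by move=> h; exists (g^-1 * c); rewrite ?mulVKg // mulgA.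
Qed.

Lemma shift_cross_at g a l : shift g (cross_at a l) = cross_at (g * a) l.
Proof. by rewrite /shift /cross_at /= link_coset_shift; case: l.2; rewrite ?mulgA. Qed.

Lemma cross_at_flip a l : cross_at (a * letter_val l) (flip l) = reverse (cross_at a l).
Proof.
rewrite /cross_at /reverse /=; congr (_, link_coset _ _, _); case: l => v [] //=.
by rewrite letter_val_flip mulgK.
Qed.

Lemma cross_at_eq a b l k :
  cross_at a l = cross_at b k <-> l = k /\ link l.1 (a^-1 * b).
Proof.
(* Elements of the link subgroup commute with the letter, so conjugation by it does not affect
   membership and either end of the edge may serve as base. *)
have conj q : link l.1 ((letter_val l)^-1 * q * letter_val l) <-> link l.1 q.
  split=> h; last by rewrite -mulgA (link_comm E_sym) // mulKg.
  suff <- : (letter_val l)^-1 * q * letter_val l = q by [].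
  by apply: (mulIg (letter_val l)); rewrite (link_comm E_sym h) -mulgA mulVKg.
have E1 : link_coset l.1 (if l.2 then a else a * letter_val l) =
    link_coset l.1 (if l.2 then b else b * letter_val l) <-> link l.1 (a^-1 * b).
  rewrite link_coset_eq; case: l.2 => //.
  by rewrite invgM -(conj (a^-1 * b)) !mulgA.
split=> [[lk + sk]|[<- /E1 h]]; last by rewrite /cross_at h.
have {}lk : l = k by case: l k lk sk {conj E1} => v s [w d] /= -> ->.
by rewrite -lk => /E1.
Qed.

Variable F : {set V}.
Hypothesis F_indep : forall v v' : V, v \in F -> v' \in F -> ~~ E v v'.

Fixpoint crossings a w : seq crossing :=
  if w is l :: w' then
    let s := crossings (a * letter_val l) w' in
    if l.1 \in F then cross_at a l :: s else s
  else [::].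

Local Notation red := (red reverse).
Local Notation reduced := (reduced reverse).
Local Notation winv := (winv reverse).

Lemma crossings_cat a u w : crossings a (u ++ w) = crossings a u ++ crossings (a * cls u) w.
Proof.
elim: u a => [|l u IH] a /=; first by rewrite mulg1.
by rewrite IH (raag_class_cons E l) mulgA; case: ifP.
Qed.

Lemma crossings_shift g a w : crossings (g * a) w = map (shift g) (crossings a w).
Proof.
elim: w a => [//|l w IH] a /=; rewrite -mulgA IH.
by case: ifP => //=; rewrite shift_cross_at.
Qed.

Lemma crossings_nil a w : all (fun l => l.1 \notin F) w -> crossings a w = [::].
Proof. by elim: w a => [//|l w IH] a /= /andP[/negbTE -> /IH]. Qed.

(** A step and its inverse give a crossing and its reverse, which cancel. Swapping commuting letters
    keeps both crossings, since each letter lies in the link of the other; the order could change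
    only if both labels were in [F], which independence forbids. *)
Lemma crossings_rel w w' a :
  raag_rel E w w' -> red (crossings a w) = red (crossings a w').
Proof.
move=> ww'; elim: ww' a => {w w'} [//|w1 w2 _ h a|w1 w2 w3 _ h1 _ h2 a|w1 w2 w1' w2' h IH1 _ IH2 a|v s a|v w vw a].
- by rewrite h.
- by rewrite h1.
- rewrite !crossings_cat; have /raag_classP <- := h.
  by apply: red_cat_eq; [exact: reverseK | exact: IH1 | exact: IH2].
- rewrite /=; case: ifP => vF; rewrite vF // (cross_at_flip a (v, s)).
  by rewrite /= eqxx.
have linkv : link v (letter_val (w, true)) by exists [:: (w, true)]; rewrite /= ?vw.
have linkw : link w (letter_val (v, true)).
  by exists [:: (v, true)]; rewrite /= ?andbT // E_sym.
have Ev : cross_at (a * letter_val (w, true)) (v, true) = cross_at a (v, true).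
  by apply/esym/cross_at_eq; rewrite mulKg.
have Ew : cross_at (a * letter_val (v, true)) (w, true) = cross_at a (w, true).
  by apply/esym/cross_at_eq; rewrite mulKg.
rewrite /= Ev Ew; case: ifP => vF; case: ifP => wF //.
by have := F_indep vF wF; rewrite vw.
Qed.

Lemma crossings_headE a w e s : crossings a w = e :: s ->
  exists p l r, [/\ w = p ++ l :: r, all (fun l => l.1 \notin F) p, l.1 \in F,
    e = cross_at (a * cls p) l & s = crossings (a * cls p * letter_val l) r].
Proof.
elim: w a => [//|l w IH] a /=; case: ifP => lF.
  by move=> [<- <-]; exists [::], l, w; rewrite mulg1.
move=> /IH[p [k [r [-> pF kF -> ->]]]]; exists (l :: p), k, r.
by rewrite (raag_class_cons E l) mulgA; split=> //=; rewrite lF.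
Qed.

Lemma crossings_split a w s e t : crossings a w = s ++ e :: t ->
  exists p l r, [/\ w = p ++ l :: r, l.1 \in F, crossings a p = s,
    e = cross_at (a * cls p) l & t = crossings (a * cls p * letter_val l) r].
Proof.
elim: w a s => [|l w IH] a s /=; first by case: s.
case: ifP => lF.
  case: s => [|e' s] [<-].
    by move=> <-; exists [::], l, w; rewrite mulg1.
  move=> /IH[p [k [r [-> kF <- -> ->]]]]; exists (l :: p), k, r.
  by rewrite (raag_class_cons E l) mulgA; split=> //=; rewrite lF.
move=> /IH[p [k [r [-> kF <- -> ->]]]]; exists (l :: p), k, r.
by rewrite (raag_class_cons E l) mulgA; split=> //=; rewrite lF.
Qed.

Lemma link_notin_F v w : v \in F -> all (fun l => E v l.1) w -> all (fun l => l.1 \notin F) w.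
Proof. by move=> vF; apply: sub_all => l /=; apply: contraL => /(F_indep vF). Qed.

(* If a geodesic crossed a hyperplane back and forth, the element spelled in between would lie in the
   subgroup generated by the link of its label, and the two crossing letters could be cancelled. *)
Lemma crossings_geodesic a w : geodesic E w -> reduced (crossings a w).
Proof.
elim: w a => [//|l w IH] a gw /=.
have gw' : geodesic E w by have [] := geodesic_cat (gw : geodesic E ([:: l] ++ w)).
case: ifP => lF; last exact: IH.
rewrite reduced_cons IH // andbT; apply/negP.
case wE : (crossings (a * letter_val l) w) => [//|e s] /= /eqP[eE].
have [p [k [r [wE' pF kF]]]] := crossings_headE wE.
rewrite eE -cross_at_flip => /cross_at_eq[fk]; rewrite mulKg => lkp _.
subst k w.
have := gw (p ++ r); rewrite !(raag_classM, raag_class_cons) letter_val_flip.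
have := link_comm E_sym (l := l) lkp => pl.
rewrite !mulgA -pl mulgK => /(_ erefl); rewrite /= !size_cat /=; lia.
Qed.

(** * The reduced crossing word between two vertices *)

Definition path_crossings x y := red (crossings x (repr (x^-1 * y))).
Local Notation P := path_crossings.

Lemma path_crossingsE x y w : cls w = x^-1 * y -> P x y = red (crossings x w).
Proof.
by move=> wE; apply: crossings_rel; apply/raag_classP; rewrite raag_class_repr.
Qed.

Lemma path_crossings_reduced x y : reduced (P x y).
Proof. exact: reduced_red. Qed.

Lemma path_crossings_cat x y z : P x z = red (P x y ++ P y z).
Proof.
have -> : P x z = red (crossings x (repr (x^-1 * y) ++ repr (y^-1 * z))).
  by apply: path_crossingsE; rewrite raag_classM !raag_class_repr mulgA mulgK.
rewrite crossings_cat raag_class_repr mulVKg.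
by rewrite (red_catl reverseK) red_catr.
Qed.

Lemma path_crossings_link v a b : v \in F -> link v (a^-1 * b) -> P a b = [::].
Proof.
move=> vF [w lw wE]; rewrite (path_crossingsE (esym wE)) crossings_nil //.
exact: link_notin_F lw.
Qed.

Lemma path_crossingsV x y : P y x = winv (P x y).
Proof.
have : red (P x y ++ P y x) = [::].
  by rewrite -path_crossings_cat (@path_crossingsE _ _ [::]) ?mulVg.
move=> /(red_winv_unique reverseK); rewrite !red_id //; exact: path_crossings_reduced.
Qed.

Lemma path_crossings_shift g x y : P (g * x) (g * y) = map (shift g) (P x y).
Proof.
have wE : cls (repr (x^-1 * y)) = (g * x)^-1 * (g * y).
  by rewrite raag_class_repr invgM -mulgA mulKg.
rewrite (path_crossingsE wE) crossings_shift (red_map (inv := reverse)) //.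
exact: shift_inj.
Qed.

Lemma path_crossings_letter a l : P a (a * letter_val l) = if l.1 \in F then [:: cross_at a l] else [::].
Proof. by rewrite (@path_crossingsE _ _ [:: l]) ?mulKg //=; case: ifP. Qed.

Lemma path_crossings_geodesic x y :
  exists w, [/\ cls w = x^-1 * y, size w = dist x y, geodesic E w & P x y = crossings x w].
Proof.
have [w [wE ws gw]] := dist_geodesic x y; exists w; split=> //.
by rewrite (path_crossingsE wE) red_id //; exact: crossings_geodesic.
Qed.

Lemma path_crossings_split x y s e t : P x y = s ++ e :: t ->
  exists a l, [/\ l.1 \in F, e = cross_at a l, P x a = s, P a y = e :: t
    & P (a * letter_val l) y = t].
Proof.
move=> sE; have := path_crossings_reduced x y; rewrite sE.
have [w [wE _ _ PE]] := path_crossings_geodesic x y.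
move: sE; rewrite PE => sE; have [p [l [r [wE' lF ps eE tE]]]] := crossings_split sE.
move=> /(reduced_cat)[rs ret].
have [_ rt] := reduced_cat (ret : reduced ([:: e] ++ t)).
exists (x * cls p), l; split=> //.
- by rewrite (@path_crossingsE _ _ p) ?mulKg // ps red_id.
- rewrite (@path_crossingsE _ _ (l :: r)).
    by rewrite /= lF -eE -tE red_id.
  by apply: (mulgI (x * cls p)); rewrite mulVKg -mulgA -raag_classM -wE' wE mulVKg.
rewrite (@path_crossingsE _ _ r); first by rewrite -tE red_id.
apply: (mulgI (x * cls p * letter_val l)); rewrite mulVKg -!mulgA -raag_class_cons.
by rewrite -raag_classM -wE' wE mulVKg.
Qed.

Lemma path_crossings_link_eq v a b c : v \in F -> link v (a^-1 * b) -> P a c = P b c.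
Proof.
move=> vF ab; rewrite (path_crossings_cat a b) (path_crossings_link vF ab) /=.
by rewrite red_id //; exact: path_crossings_reduced.
Qed.

(** The edge at [a] need not lie on the chosen geodesic: it differs from the edge there by an
    element of the link subgroup, and paths labelled by neighbours of a vertex of [F] cross nothing
    labelled in [F]. *)
Lemma path_crossings_split_at x y s t a l : l.1 \in F ->
  P x y = s ++ cross_at a l :: t ->
  [/\ P x a = s, P a y = cross_at a l :: t, P x (a * letter_val l) = rcons s (cross_at a l)
    & P (a * letter_val l) y = t].
Proof.
move=> lF sE; have [b [k [kF /cross_at_eq[lk ab] xb bY bkY]]] := path_crossings_split sE.
subst k.
have ab' : link l.1 ((a * letter_val l)^-1 * (b * letter_val l)).
  rewrite invgM !mulgA -[_ * _ * b]mulgA -mulgA (link_comm E_sym ab) mulKg //.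
split.
- by rewrite path_crossingsV (path_crossings_link_eq x lF ab) -path_crossingsV.
- by rewrite (path_crossings_link_eq y lF ab).
- rewrite (path_crossings_cat x a) path_crossings_letter lF.
  rewrite path_crossingsV (path_crossings_link_eq x lF ab) -path_crossingsV xb.
  rewrite cats1 red_id //; have := path_crossings_reduced x y; rewrite sE.
  by rewrite -cat_rcons => /(reduced_cat)[].
by rewrite (path_crossings_link_eq y lF ab').
Qed.

(** If [c] is closer to the end of the edge, a geodesic from [c] to that end followed by the edge is
    a geodesic to [a]. Conversely, if the last [F]-crossing of a geodesic from [c] to [a] is this
    hyperplane, the rest lies in the link subgroup; the crossing letter commutes past it, and
    dropping it gives a shorter path to the end. *)
Lemma side_crossing a l c : l.1 \in F ->
  side (a * letter_val l) a c <-> ohead (P a c) = Some (cross_at a l).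
Proof.
move=> lF; rewrite path_crossingsV /side /=; split=> h; last first.
  have [w [wE ws gw PE]] := path_crossings_geodesic c a.
  move: h; rewrite PE; move zE : (crossings c w) => z.
  case/lastP: z zE => [//|s e]; rewrite winv_rcons -cats1 => sE /Some_inj eE.
  have [p [k [r [wE' kF ps eE' tE]]]] := crossings_split sE.
  move: eE; rewrite eE' -cross_at_flip => /cross_at_eq[/= fk lk].
  have {fk}kE : k = flip l by rewrite -fk flipK.
  subst k w; have aE : a = c * cls p * (letter_val l)^-1 * cls r.
    rewrite -letter_val_flip -mulgA -raag_class_cons -mulgA -raag_classM wE.
    by rewrite mulVKg.
  have lr : link l.1 (cls r).
    by move: lk; rewrite aE letter_val_flip mulKg.
  rewrite -ws size_cat /= addnS ltnS -size_cat; apply: dist_le.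
  apply: (mulgI c); rewrite mulVKg aE raag_classM -!mulgA (link_comm E_sym lr).
  by rewrite mulKg.
have [w [wE ws gw]] := dist_geodesic c (a * letter_val l).
have wl : cls (rcons w (flip l)) = c^-1 * a.
  by rewrite raag_class_rcons wE letter_val_flip !mulgA mulgK.
rewrite (path_crossingsE wl) red_id; last first.
  apply: crossings_geodesic => z; rewrite wl size_rcons ws => zE.
  exact: leq_trans h (dist_le zE).
rewrite -cats1 crossings_cat /= lF cats1 winv_rcons /= wE mulVKg cross_at_flip.
by rewrite reverseK.
Qed.

Lemma side_self a l : l.1 \in F ->
  side (a * letter_val l) a (a * letter_val l) /\ ~ side (a * letter_val l) a a.
Proof.
move=> lF; rewrite !side_crossing // path_crossings_letter lF; split=> //.
by rewrite (@path_crossingsE a a [::]) ?mulVg.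
Qed.

(** This identifies the letters of [P x y] with the halfspaces of $[x,y]$ labelled in [F]. *)
Lemma mem_path_crossings x y a l : l.1 \in F ->
  cross_at a l \in P x y <->
  ~ side (a * letter_val l) a x /\ side (a * letter_val l) a y.
Proof.
move=> lF; rewrite !side_crossing //; split=> [|[hx hy]].
  move PE : (P x y) => z ez; case/splitPr: ez PE => s t PE.
  have [xa ay _ _] := path_crossings_split_at lF PE.
  split; last by rewrite ay.
  have := path_crossings_reduced x y; rewrite PE path_crossingsV xa.
  case/lastP: s {PE xa} => [//|s e]; rewrite reduced_cat_rcons winv_rcons.
  by move=> /andP[_ /eqP ne] /= eE; case: ne; rewrite /= -eE.
(* The vertices lie on different sides, so [P a x] and [P a y] begin differently and nothing cancels
   at [a]; the crossing at the head of [P a y] survives. *)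
have -> : P x y = winv (P a x) ++ P a y.
  rewrite (path_crossings_cat x a) -path_crossingsV red_id // path_crossingsV.
  apply: reduced_cat_winv; rewrite ?path_crossings_reduced //; first exact: reverseK.
  by rewrite hy; apply/eqP => /esym.
by case: (P a y) hy => [//|e s] /Some_inj ->; rewrite mem_cat mem_head orbT.
Qed.

Lemma side_cross_at_eq a l b k : l.1 \in F -> k.1 \in F ->
  side (a * letter_val l) a = side (b * letter_val k) b <-> cross_at a l = cross_at b k.
Proof.
move=> lF kF; split=> [e|e].
  have : cross_at a l \in P a (a * letter_val l).
    by rewrite path_crossings_letter lF mem_head.
  rewrite mem_path_crossings // e -mem_path_crossings // path_crossings_letter lF.
  by rewrite inE => /eqP.
apply/seteqP; split=> c.
  by rewrite !side_crossing // e; have [_ /(path_crossings_link_eq c lF) ->] := (cross_at_eq a b l k).1 e.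
by rewrite !side_crossing // e; have [_ /(path_crossings_link_eq c lF) ->] := (cross_at_eq a b l k).1 e.
Qed.

(** If the last crossing, at the edge leaving [a], had occurred before, then [a] would already lie
    in the halfspace that this edge enters. *)
Lemma path_crossings_uniq x y : uniq (P x y).
Proof.
move PE : (P x y) => z; elim/last_ind: z x y PE => [//|s e IH] x y PE.
have [a [l [lF eE xa ay _]]] := path_crossings_split (etrans PE (esym (cats1 s e))).
rewrite rcons_uniq (IH x a) // andbT; apply/negP => es; subst e.
move: es; rewrite -xa mem_path_crossings // !side_crossing // => -[_].
by rewrite (@path_crossingsE a a [::]) ?mulVg.
Qed.

(** Cutting [P x y] just before the outer crossing and the remainder just after the inner one
    isolates a consecutive subword. This turns nested halfspaces in an interval into windows. *)
Lemma path_crossings_window x y a l b k : l.1 \in F -> k.1 \in F ->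
  side (b * letter_val k) b `<=` side (a * letter_val l) a ->
  ~ side (a * letter_val l) a x -> side (b * letter_val k) b y ->
  exists s t, P x y = s ++ P a (b * letter_val k) ++ t.
Proof.
move=> lF kF ba xa yb.
have eP : cross_at a l \in P x y by apply/mem_path_crossings => //; split=> //; exact: ba.
have e'P : cross_at b k \in P x y by apply/mem_path_crossings => //; split=> // /ba.
have [s [t PE]] : exists s t, P x y = s ++ cross_at a l :: t.
  by case/splitPr: eP => s t; exists s, t.
have [xs ay _ _] := path_crossings_split_at lF PE.
have aNa := (side_self a lF).2.
have : cross_at b k \in P a y by apply/mem_path_crossings => //; split=> // /ba.
move PaE : (P a y) => z ez; case/splitPr: ez PaE => u w PaE.
have [au _ abk _] := path_crossings_split_at kF PaE.
by exists s, w; rewrite PE -ay PaE abk cat_rcons.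
Qed.

End Crossings.

(** * Median counts are window counts *)

Lemma card_fset_set_bigcup (I K : choiceType) (r : seq I) (A : I -> set K) :
  uniq r -> (forall i, i \in r -> finite_set (A i)) ->
  (forall i j x, i \in r -> j \in r -> A i x -> A j x -> i = j) ->
  finite_set (\bigcup_(i in [set` r]) A i) /\
  #|` fset_set (\bigcup_(i in [set` r]) A i)| = (\sum_(i <- r) #|` fset_set (A i)|)%N.
Proof.
elim: r => [|i r IH] /=.
  move=> _ _ _; have -> : [set` [::]] = set0 :> set I by apply/seteqP; split=> x.
  by rewrite bigcup_set0 big_nil fset_set0 cardfs0; split.
move=> /andP[ir ur] Af Ad.
have [|j k x jr kr|rf rE] := IH ur.
- by move=> j jr; apply: Af; rewrite inE jr orbT.
- by apply: Ad; rewrite inE ?jr ?kr orbT.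
have -> : [set` i :: r] = i |` [set` r].
  apply/seteqP; split=> x; rewrite /= inE; first by move=> /orP[/eqP ->|]; [left|right].
  by move=> [->|xr]; apply/orP; [left|right].
have Aif : finite_set (A i) by apply: Af; rewrite mem_head.
rewrite bigcup_setU1 big_cons; split; first by rewrite finite_setU.
rewrite fset_setU // -rE cardfsU.
suff -> : (fset_set (A i) `&` fset_set (\bigcup_(j in [set` r]) A j))%fset = fset0.
  by rewrite cardfs0 subn0.
apply/fsetP => x; rewrite !inE !in_fset_set //; apply/negP => /andP[].
rewrite !inE => Aix [j /= jr Ajx]; have ij : i = j.
  by apply: Ad Aix Ajx; rewrite inE ?eqxx ?jr ?orbT.
by move: ir; rewrite ij jr.
Qed.

Lemma fset_set_infinite (K : choiceType) (A : set K) : ~ finite_set A -> fset_set A = fset0.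
Proof. by rewrite /fset_set; case: pselect. Qed.

Lemma card_fset_set_can (K K' : choiceType) (f : K -> K') f' (A : set K) :
  cancel f f' -> #|` fset_set (f @` A)| = #|` fset_set A|.
Proof.
move=> fK; have [Af|Ainf] := pselect (finite_set A).
  by rewrite fset_set_image // card_imfset //; exact: can_inj fK.
rewrite !fset_set_infinite // => /(finite_image f') fA; apply: Ainf.
suff -> : A = f' @` (f @` A) by [].
by rewrite image_comp; apply/seteqP; split=> [x Ax|x [y Ay <-]]; [exists x|]; rewrite /= ?fK.
Qed.

(** * Translates of a segment as windows of the crossing word *)

Section MedianCounting.
Variables (V : finType) (E : rel V).
Hypothesis E_sym : symmetric E.
Variable F : {set V}.
Hypothesis F_indep : forall v v' : V, v \in F -> v' \in F -> ~~ E v v'.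
Variable s : seq (set (raag E)).
Hypothesis s_segment : segment s.
Hypothesis s_head : exists2 v, v \in F & has_label (head set0 s) v.
Hypothesis s_last : exists2 v, v \in F & has_label (last set0 s) v.
Local Notation Gamma := (raag E).
Local Notation letter_val := (letter_val E).
Local Notation P := (path_crossings F).
Local Notation winv := (winv (@reverse V E)).
Local Open Scope group_scope.
Implicit Types (a b g x y : Gamma) (w : seq (crossing E)) (l k : V * bool) (h : set Gamma).

Lemma translate_comp g a (t : seq (set Gamma)) : translate g (translate a t) = translate (g * a) t.
Proof.
rewrite /translate -map_comp; apply: eq_map => h /=; rewrite image_comp.
by apply: eq_imagel => c _ /=; rewrite mulgA.
Qed.

Lemma translate1 (t : seq (set Gamma)) : translate 1 t = t.
Proof.
rewrite /translate -[RHS]map_id; apply: eq_map => h /=.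
apply/seteqP; split=> c; first by move=> [d hd <-]; rewrite mul1g.
by exists c; rewrite ?mul1g.
Qed.

Lemma translateK g : cancel (translate g) (@translate V E g^-1).
Proof. by move=> t; rewrite translate_comp mulVg translate1. Qed.

Lemma segment_nested i j : (i <= j < size s)%N -> nth set0 s j `<=` nth set0 s i.
Proof.
move=> /andP[+ js]; elim: j js => [|j IH] js; first by rewrite leqn0 => /eqP ->.
rewrite leq_eqVlt => /orP[/eqP -> //|ij].
have [_ _ /(_ j js)[nested _ _]] := s_segment.
by apply: subset_trans (IH _ ij); last exact: ltnW.
Qed.

Lemma segment_data : exists a l b k, [/\ l.1 \in F, k.1 \in F,
  head set0 s = side (a * letter_val l) a, last set0 s = side (b * letter_val k) b &
  side (b * letter_val k) b `<=` side (a * letter_val l) a].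
Proof.
have [v vF /label_letter[a [l [lv hE]]]] := s_head.
have [v' v'F /label_letter[b [k [kv lE]]]] := s_last.
exists a, l, b, k; rewrite lv kv -hE -lE; split=> //.
have [s0 _ _] := s_segment; rewrite -nth0 -nth_last; apply: segment_nested; lia.
Qed.

(** By nestedness a translate lies in the interval as soon as its largest halfspace misses [x] and
    its smallest one contains [y]; only the two ends, with labels in [F], have to be tested. *)
Lemma translates_inE x y a l b k : l.1 \in F -> k.1 \in F ->
  head set0 s = side (a * letter_val l) a -> last set0 s = side (b * letter_val k) b ->
  translates_in s x y = [set t | exists2 g, t = translate g s &
    ~ side (g * a * letter_val l) (g * a) x /\ side (g * b * letter_val k) (g * b) y].
Proof.
move=> lF kF hE lE; have [s0 shalf _] := s_segment.
have headE g : [set g * c | c in head set0 s] = side (g * a * letter_val l) (g * a).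
  by rewrite hE side_mul mulgA.
have lastE g : [set g * c | c in last set0 s] = side (g * b * letter_val k) (g * b).
  by rewrite lE side_mul mulgA.
have s_nth h : h \in s -> last set0 s `<=` h /\ h `<=` head set0 s.
  move=> hs; rewrite -nth0 -nth_last -(nth_index set0 hs).
  have is_ : (index h s < size s)%N by rewrite index_mem.
  split; apply: segment_nested; lia.
apply/seteqP; split=> t /=.
  move=> [[g tE] tP]; exists g => //; rewrite -headE -lastE; split.
    have [|_ _] // := tP [set g * c | c in head set0 s].
    by rewrite tE; apply: map_f; rewrite -nth0 mem_nth.
  have [|_ //] := tP [set g * c | c in last set0 s].
  by rewrite tE; apply: map_f; rewrite -nth_last mem_nth // ltn_predL.
move=> [g tE]; rewrite -headE -lastE => -[hx ly]; split; first by exists g.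
move=> h; rewrite tE => /mapP[h' hs ->]; have [lh hh] := s_nth _ hs; split.
- by have [c [m ->]] := halfspace_letter (shalf _ hs); rewrite side_mul mulgA; exact: side_halfspace.
- by move: ly => [c /lh hc <-]; exists c.
- by move=> [c /hh hc xE]; apply: hx; exists c.
Qed.

(** Let [W] be the crossing word from the first to the last halfspace of [s]. A translate $gs$ lies
    in $[x,y]$ exactly when $gW$ is a window of [P x y], and a word is weighted by the number of
    translates with that crossing word. *)
Lemma median_count_wsum (R : realType) : exists (phi : seq (crossing E) -> R) D M,
  [/\ forall w, phi (winv w) = - phi w,
      forall w, (D < size w)%N -> phi w = 0,
      forall w, `|phi w| <= M,
      forall g w, phi (map (shift g) w) = phi w &
      forall x y, median_count R s x y = wsum phi (P x y)]%R.
Proof.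
have [a [l [b [k [lF kF hE lE ba]]]]] := segment_data.
pose W := P a (b * letter_val k).
pose fib w := [set t | exists2 g, t = translate g s & map (shift g) W = w].
pose phi0 w : R := (#|` fset_set (fib w)|%:R)%R.
have fib_shift g w : fib (map (shift g) w) = translate g @` fib w.
  have sh1 c d : map (shift c) (map (shift d) W) = map (shift (c * d)) W.
    by rewrite /W -!path_crossings_shift // !mulgA.
  apply/seteqP; split=> t /=.
    move=> [c -> cW]; exists (translate (g^-1 * c) s); last by rewrite translate_comp mulVKg.
    exists (g^-1 * c) => //; rewrite -sh1 cW /W; apply: (inj_map (@shift_inj _ _ g)).
    by rewrite -cW !sh1 mulgA mulgV mul1g.
  by move=> [_ [c -> <-] <-]; exists (g * c); rewrite ?translate_comp // sh1.
have phi0_shift g w : phi0 (map (shift g) w) = phi0 w.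
  by rewrite /phi0 fib_shift (card_fset_set_can _ (@translateK g)).
have fibW w t : fib w t -> exists g, map (shift g) W = w by move=> [g _ <-]; exists g.
(* Every nonempty fibre is a translate of the fibre over [W], so [phi0] takes only the values 0 and
   [phi0 W]. *)
have phi0_bd w : (0 <= phi0 w <= phi0 W)%R.
  rewrite ler0n /=; have [[t /fibW[g <-]]|nw] := pselect (exists t, fib w t).
    by rewrite phi0_shift.
  have -> : phi0 w = 0%R; last by rewrite ler0n.
  rewrite /phi0 (_ : fib w = set0) ?fset_set0 //.
  by apply/seteqP; split=> // t wt; apply: nw; exists t.
have phi0_long w : (size W < size w)%N -> phi0 w = 0%R.
  move=> Ww; rewrite /phi0 (_ : fib w = set0) ?fset_set0 //.
  by apply/seteqP; split=> // t /fibW[g wE]; move: Ww; rewrite -wE size_map ltnn.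
have aW : cross_at a l \in W.
  apply/mem_path_crossings => //; split; first exact: (side_self E_sym F_indep _ lF).2.
  exact/ba/(side_self E_sym F_indep _ kF).1.
have bW : cross_at b k \in W.
  apply/mem_path_crossings => //; split; last exact: (side_self E_sym F_indep _ kF).1.
  by move=> /ba; exact: (side_self E_sym F_indep _ lF).2.
(* A translate is seen in one window only: its first halfspace fixes the starting crossing, which
   occurs once in [P x y], and the length of [W] fixes the end. *)
have cut_inj x y i j i' j' t : (i < j <= size (P x y))%N -> (i' < j' <= size (P x y))%N ->
    fib (window i j (P x y)) t -> fib (window i' j' (P x y)) t -> (i, j) = (i', j').
  move=> ij ij' [g -> gW] [g' tE g'W].
  have eE : cross_at (g * a) l = cross_at (g' * a) l.
    apply/(side_cross_at_eq E_sym F_indep) => //; rewrite -!mulgA -!side_mul -hE.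
    have [s0 _ _] := s_segment; move: tE; rewrite /translate; case: (s) s0 => //= h s' _.
    by case.
  have Wh : ohead W = Some (cross_at a l) by apply/side_crossing => //; exact/ba/(side_self E_sym F_indep _ _).1.
  have iE i1 j1 c : (i1 < j1 <= size (P x y))%N -> map (shift c) W = window i1 j1 (P x y) ->
      i1 = index (cross_at (c * a) l) (P x y).
    move=> /andP[i1j1 j1n] cW.
    have : ohead (window i1 j1 (P x y)) = Some (cross_at (c * a) l).
      by rewrite -cW -shift_cross_at; case: (W) Wh => [//|e w] /= /Some_inj ->.
    rewrite /window; case wE : (drop _ _) => [//|e w] /= /Some_inj <-.
    have -> : e = nth e (P x y) i1.
      by rewrite -(nth_take (n0 := j1)) // -[in RHS](addn0 i1) -nth_drop wE.
    by rewrite index_uniq ?path_crossings_uniq //; lia.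
  have ii' : i = i' by rewrite (iE i j g) // (iE i' j' g') // eE.
  have jE i1 j1 c : (i1 < j1 <= size (P x y))%N -> map (shift c) W = window i1 j1 (P x y) ->
      j1 = (i1 + size W)%N.
    by move=> /andP[h1 h2] /(congr1 size); rewrite size_map size_window // => ->; rewrite subnKC // ltnW.
  by rewrite (jE i j g) // (jE i' j' g') // ii'.
have W0 : (0 < size W)%N by move: aW; case: (W).
have count x y : (#|` fset_set (translates_in s x y)|%:R =
    tri (size (P x y)) (fun i j => phi0 (window i j (P x y))) :> R)%R.
  pose r := [seq (i, j) | i <- index_iota 0 (size (P x y)), j <- index_iota i.+1 (size (P x y)).+1].
  have rP i j : ((i, j) \in r) = (i < j <= size (P x y))%N.
    apply/allpairsPdep/idP => [[i' [j' []]]|ij].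
      by rewrite !mem_index_iota => h h' [-> ->]; lia.
    by exists i, j; rewrite !mem_index_iota; split=> //; lia.
  have rU : uniq r.
    apply: allpairs_uniq_dep => //; first exact: iota_uniq.
      by move=> i _; exact: iota_uniq.
    by move=> [i j] [i' j'] _ _ /= [-> ->].
  have TE : translates_in s x y = \bigcup_(p in [set` r]) fib (window p.1 p.2 (P x y)).
    rewrite (translates_inE x y lF kF hE lE); apply/seteqP; split=> t /=.
      move=> [g tE [gx gy]].
      have [] := path_crossings_window E_sym F_indep lF kF _ gx gy.
        by rewrite -!mulgA -!side_mul; exact: image_subset.
      move=> s1 [t1 PE]; have WE : map (shift g) W = P (g * a) (g * b * letter_val k).
        by rewrite /W -path_crossings_shift // mulgA.
      exists (size s1, size s1 + size W)%N.
        by rewrite /= rP PE !size_cat -WE size_map -{1}[size s1]addn0 ltn_add2l W0 leq_add2l leq_addr.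
      exists g => //=; rewrite PE -WE -[X in window X]addn0 window_catr.
      by rewrite -(size_map (shift g) W) /window take_size_cat // drop0.
    move=> [[i j] /=]; rewrite rP => /andP[ij jn] [g -> gW]; exists g => //.
    have sub : {subset map (shift g) W <= P x y}.
      by move=> e; rewrite gW => /mem_drop /mem_take.
    have := sub _ (map_f (shift g) aW); have := sub _ (map_f (shift g) bW).
    by rewrite !shift_cross_at => /mem_path_crossings[] // _ ? /mem_path_crossings[].
  have triE : (tri (size (P x y)) (fun i j => phi0 (window i j (P x y))) =
      \sum_(p <- r) phi0 (window p.1 p.2 (P x y)) :> R)%R.
    by rewrite big_allpairs_dep.
  have [Wf|Winf] := pselect (finite_set (fib W)).
    rewrite triE -natr_sum; congr (_%:R)%R; rewrite TE.
    have [||] // := card_fset_set_bigcup (A := fun p => fib (window p.1 p.2 (P x y))) rU.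
      move=> [i j] _ /=; have [[t /fibW[g <-]]|nw] := pselect (exists t, fib (window i j (P x y)) t).
        by rewrite fib_shift; exact: finite_image.
      suff -> : fib (window i j (P x y)) = set0 by [].
      by apply/seteqP; split=> // t wt; apply: nw; exists t.
    by move=> [i j] [i' j'] t; rewrite !rP => h h'; exact: cut_inj.
  (* If the fibre over [W] is infinite, so is every nonempty fibre. As [fset_set] is empty on
     infinite sets, both sides of the identity are then 0. *)
  have inf w t : fib w t -> ~ finite_set (fib w).
    move=> /fibW[g <-]; rewrite fib_shift => /(finite_image (translate g^-1)) fA; apply: Winf.
    suff -> : fib W = translate g^-1 @` (translate g @` fib W) by [].
    by rewrite image_comp; apply/seteqP; split=> [t' ft'|t' [z fz <-]]; [exists t'|]; rewrite /= ?translateK.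
  have phi00 w : phi0 w = 0%R.
    rewrite /phi0; have [[t wt]|nw] := pselect (exists t, fib w t).
      by rewrite fset_set_infinite //; exact: inf wt.
    rewrite (_ : fib w = set0) ?fset_set0 //.
    by apply/seteqP; split=> // t wt; apply: nw; exists t.
  rewrite triE big1 //; have [[t wt]|nw] := pselect (exists t, translates_in s x y t); last first.
    by rewrite (_ : translates_in s x y = set0) ?fset_set0 //; apply/seteqP; split=> // t wt; apply: nw; exists t.
  rewrite fset_set_infinite //; move: wt; rewrite TE => -[p pr pt] /sub_finite_set fT.
  by apply: (inf _ _ pt); apply: fT => t' pt'; exists p.
(* Translates in $[y,x]$ are windows of [winv (P x y)], so subtracting their number amounts to
   antisymmetrising the weight. *)
exists (fun w => phi0 w - phi0 (winv w))%R, (size W), (phi0 W); split.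
- by move=> w; rewrite winvK ?opprB //; exact: reverseK.
- by move=> w Ww; rewrite !phi0_long ?size_winv ?subr0.
- by move=> w; have := phi0_bd w; have := phi0_bd (winv w); rewrite ler_norml; lra.
- move=> g w; rewrite phi0_shift; congr (_ - _)%R.
  by rewrite -(phi0_shift g (winv w)) /winv map_rev -!map_comp.
move=> x y; rewrite /median_count !count (path_crossingsV E_sym F_indep x y) size_winv.
rewrite /wsum [X in (_ - X)%R]tri_rev -tri_opp -tri_add; apply: eq_tri => i j /andP[ij jn].
have jn0 : (i <= size (P x y))%N by exact: leq_trans (ltnW ij) jn.
by rewrite window_winv ?ltn_sub2l ?leq_subr ?subKn // (leq_trans ij).
Qed.

End MedianCounting.

(** * Vanishing of cup products *)

Section ShiftInvariance.
Variables (L : eqType) (inv shift : L -> L) (R : realFieldType).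
Hypothesis shift_inj : injective shift.
Hypothesis shift_inv : {morph shift : a / inv a}.
Variables phi psi : seq L -> R.
Hypothesis phi_shift : forall w, phi (map shift w) = phi w.
Hypothesis psi_shift : forall w, psi (map shift w) = psi w.

Lemma window_map i j (w : seq L) : window i j (map shift w) = map shift (window i j w).
Proof. by rewrite /window -map_take map_drop. Qed.

Lemma wsum_map w : wsum phi (map shift w) = wsum phi w.
Proof.
by rewrite /wsum size_map; apply: eq_tri => i j _; rewrite window_map phi_shift.
Qed.

Lemma count_qm_map w : count_qm inv phi (map shift w) = count_qm inv phi w.
Proof. by rewrite /count_qm red_map // wsum_map. Qed.

Lemma integral_map q r :
  integral psi (count_qm inv phi) (map shift q) (map shift r) =
  integral psi (count_qm inv phi) q r.
Proof.
rewrite /integral size_map; apply: eq_tri => i j _.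
by rewrite window_map psi_shift -!map_take -!map_cat !count_qm_map.
Qed.

End ShiftInvariance.

(** * Classes represented by weights *)

Section CupVanishing.
Variables (R : realType) (V : finType) (E : rel V).
Hypothesis E_sym : symmetric E.
Variables (x : raag E) (F : {set V}).
Hypothesis F_indep : forall v v' : V, v \in F -> v' \in F -> ~~ E v v'.
Local Notation Gamma := (raag E).
Local Notation P := (path_crossings F).
Local Notation winv := (winv (@reverse V E)).
Local Notation count_qm := (count_qm (@reverse V E)).
Local Notation word_fun := (seq (crossing E) -> R).

Definition counting_weight (phi : word_fun) (D : nat) (M : R) :=
  [/\ forall w, phi (winv w) = - phi w,
      forall w, (D < size w)%N -> phi w = 0,
      forall w, `|phi w| <= M &
      forall g w, phi (map (shift g) w) = phi w].

Definition counting_cochain (phi : word_fun) : cochain R Gamma 1 :=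
  fun c => wsum phi (P (c ord0 * x)%g (c ord_max * x)%g).

(** With [D] and [M] left free these classes are closed under linear combinations. An element of the
    span is thus given by a single weight, and one pair of weights suffices for the cup product. *)
Definition counting_class (u : Hb R Gamma 2) := exists (phi : word_fun) D M (z : bZ R Gamma 2),
  [/\ counting_weight phi D M, bZ_val z = delta (counting_cochain phi) & u = bclass z].

Lemma counting_class0 : counting_class 0.
Proof.
exists (fun=> 0), 0%N, 0, 0; split; last by rewrite -[LHS](subrr (bclass (0 : bZ R Gamma 2))) -bclassB subrr.
  by split=> // *; rewrite ?oppr0 ?normr0.
rewrite (_ : counting_cochain _ = 0) ?linear0 //; apply/funext => c.
by rewrite /counting_cochain /wsum /tri big1 // => i _; rewrite big1.
Qed.

Lemma counting_classD u v : counting_class u -> counting_class v -> counting_class (u + v).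
Proof.
move=> [phi [D [M [z [[p1 p2 p3 p4] zE ->]]]]] [psi [D' [M' [z' [[q1 q2 q3 q4] zE' ->]]]]].
exists (fun w => phi w + psi w), (maxn D D'), (M + M'), (z + z'); split; last by rewrite bclassD.
  split=> [w|w|w|g w].
  - by rewrite p1 q1 opprD.
  - by rewrite gtn_max => /andP[Dw D'w]; rewrite p2 // q2 // addr0.
  - by rewrite (le_trans (ler_normD _ _)) // lerD.
  by rewrite p4 q4.
rewrite (_ : counting_cochain _ = counting_cochain phi + counting_cochain psi).
  by rewrite linearD /= -zE -zE'.
by apply/funext => c; rewrite /counting_cochain /wsum tri_add.
Qed.

Lemma counting_classZ a u : counting_class u -> counting_class (a *: u).
Proof.
move=> [phi [D [M [z [[p1 p2 p3 p4] zE ->]]]]].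
exists (fun w => a * phi w), D, (`|a| * M), (a *: z); split; last by rewrite bclassZ.
  split=> [w|w Dw|w|g w]; rewrite ?p1 ?mulrN ?p4 //; first by rewrite p2 ?mulr0.
  by rewrite normrM ler_wpM2l.
rewrite (_ : counting_cochain _ = a *: counting_cochain phi).
  by rewrite linearZ /= -zE.
by apply/funext => c; rewrite /counting_cochain /wsum tri_scale.
Qed.

Lemma median_counting_weight (s : seq (set Gamma)) : segment s ->
  (exists2 v, v \in F & has_label (head set0 s) v) ->
  (exists2 v, v \in F & has_label (last set0 s) v) ->
  exists phi D M, counting_weight phi D M /\ hat (median_qm R s x) = counting_cochain phi.
Proof.
move=> ss sh sl; have [phi [D [M [p1 p2 p3 p4 phiE]]]] := median_count_wsum E_sym F_indep ss sh sl R.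
exists phi, D, M; split=> //; apply/funext => c.
rewrite /hat /median_qm phiE /counting_cochain.
rewrite -(wsum_map (p4 (c ord0))) -path_crossings_shift //.
by rewrite !mulgA mulgV mul1g.
Qed.

Lemma median_span_counting u : median_span R x F u -> counting_class u.
Proof.
move=> [n [c [w [wP ->]]]]; apply: (big_ind counting_class).
- exact: counting_class0.
- exact: counting_classD.
move=> i _; apply: counting_classZ; have [s [ss sh sl [z zE ->]]] := wP i.
have [phi [D [M [pw hE]]]] := median_counting_weight ss sh sl.
by exists phi, D, M, z; split=> //; rewrite zE hE.
Qed.

(** * A bounded primitive of the cup product *)

Section Primitive.
Variables (phi psi : word_fun) (D : nat) (M : R).
Hypotheses (phi_weight : counting_weight phi D M) (psi_weight : counting_weight psi D M).
Implicit Types y : Gamma.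

Let f y0 y1 := wsum phi (P y0 y1).
Let g y0 y1 := wsum psi (P y0 y1).
Let eta y0 y1 y2 := integral psi (count_qm phi) (P y0 y1) (P y1 y2).
Let theta y0 y1 := integral psi (count_qm phi) [::] (P y0 y1).

(** This is $f\cup\delta g+\frac12\delta\eta-\frac12\delta\omega$ with
    $\omega(y_0,y_1,y_2)=\theta(y_1,y_2)$. The factor $\frac12$ compensates for the evaluation of
    [f] at both ends of each window. *)
Definition cup_primitive y0 y1 y2 y3 : R :=
  f y0 y1 * (g y2 y3 - g y1 y3 + g y1 y2)
  + 2^-1 * (eta y1 y2 y3 - eta y0 y2 y3 + eta y0 y1 y3 - eta y0 y1 y2)
  - 2^-1 * (theta y1 y3 - theta y1 y2).

Lemma cup_primitive_shift a y0 y1 y2 y3 :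
  cup_primitive (a * y0)%g (a * y1)%g (a * y2)%g (a * y3)%g = cup_primitive y0 y1 y2 y3.
Proof.
have [_ _ _ /(_ a) phiS] := phi_weight; have [_ _ _ /(_ a) psiS] := psi_weight.
rewrite /cup_primitive /f /g /eta /theta !path_crossings_shift //.
rewrite !(wsum_map phiS) !(wsum_map psiS).
have I := integral_map (@shift_inj _ _ a) (@shift_reverse _ _ a) phiS psiS.
have I0 r : integral psi (count_qm phi) [::] (map (shift a) r) =
  integral psi (count_qm phi) [::] r := I [::] r.
by rewrite !I !I0.
Qed.

(** Half of [integral_cocycle], read with [P y0 y1], [P y1 y2], [P y2 y3] as the three words. *)
Lemma cup_primitive_bounded : exists K, forall y0 y1 y2 y3,
  `|cup_primitive y0 y1 y2 y3| <= K.
Proof.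
have [p1 p2 p3 _] := phi_weight; have [q1 q2 q3 _] := psi_weight.
have rK := @reverseK V E.
have [K hK] := integral_cocycle rK q1 q2 q3 (count_qm_red _ phi)
  (count_qm_defect rK p1 p2 p3) (count_qm_bound _ p3).
exists (2^-1 * K) => y0 y1 y2 y3; have := hK (P y0 y1) (P y1 y2) (P y2 y3).
rewrite -path_crossings_cat // => /(_ (path_crossings_reduced _ _ _) (path_crossings_reduced _ _ _)).
rewrite (integral_red (inv := @reverse V E) (q := P y0 y1 ++ P y1 y2) (q' := P y0 y2) rK _ (count_qm_red _ phi)).
  have -> : count_qm phi (P y0 y1) = f y0 y1 by rewrite /count_qm red_id ?path_crossings_reduced.
  rewrite /cup_primitive /f /g /eta /theta !ler_norml; lra.
by rewrite -path_crossings_cat // red_id // path_crossings_reduced.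
Qed.

(** The corrections are coboundaries and drop out, leaving $\delta(f\cup\delta g)=\delta f\cup\delta
    g$. *)
Lemma cup_primitive_delta y0 y1 y2 y3 y4 :
  (f y1 y2 - f y0 y2 + f y0 y1) * (g y3 y4 - g y2 y4 + g y2 y3) =
  cup_primitive y1 y2 y3 y4 - cup_primitive y0 y2 y3 y4 + cup_primitive y0 y1 y3 y4
  - cup_primitive y0 y1 y2 y4 + cup_primitive y0 y1 y2 y3.
Proof. by rewrite /cup_primitive; field. Qed.

End Primitive.

Lemma delta_counting phi (c : 'I_3 -> Gamma) :
  delta (counting_cochain phi) c =
    wsum phi (P (c (inord 1) * x)%g (c (inord 2) * x)%g)
    - wsum phi (P (c (inord 0) * x)%g (c (inord 2) * x)%g)
    + wsum phi (P (c (inord 0) * x)%g (c (inord 1) * x)%g).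
Proof.
rewrite /delta /counting_cochain !big_ord_recl big_ord0 /=.
have E3 (i : 'I_3) k : nat_of_ord i = k -> i = inord k by move=> <-; rewrite inord_val.
rewrite expr0 expr1 mul1r mulN1r addr0 /bump /= -signr_odd /= expr0 mul1r addrA.
by congr (wsum _ (P (c _ * x)%g (c _ * x)%g) - wsum _ (P (c _ * x)%g (c _ * x)%g)
   + wsum _ (P (c _ * x)%g (c _ * x)%g)); apply: E3.
Qed.

Theorem cup_counting_class u v : counting_class u -> counting_class v ->
  Hb_cup u v = 0 :> Hb R Gamma 4.
Proof.
move=> [phi [D1 [M1 [z [[p1 p2 p3 p4] zE ->]]]]] [psi [D2 [M2 [z' [[q1 q2 q3 q4] zE' ->]]]]].
(* The estimates use one length bound and one size bound for both weights, so the maxima are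
   taken. *)
have pw : counting_weight phi (maxn D1 D2) (Num.max M1 M2).
  by split=> // [w|w]; [rewrite gtn_max => /andP[/p2]|rewrite le_max p3].
have qw : counting_weight psi (maxn D1 D2) (Num.max M1 M2).
  by split=> // [w|w]; [rewrite gtn_max => /andP[_ /q2]|rewrite le_max q3 orbT].
rewrite Hb_cup_bclass -[RHS](subrr (bclass (0 : bZ R Gamma 4))) -bclassB subrr.
apply/bclass_eqP; rewrite subr0.
pose o i (h : (i < 4)%N) : 'I_4 := Ordinal h.
pose h : cochain R Gamma 3 := fun c =>
  cup_primitive phi psi (c (@o 0%N isT) * x)%g (c (@o 1%N isT) * x)%g
    (c (@o 2%N isT) * x)%g (c (@o 3%N isT) * x)%g.
apply: (@is_bcoboundary_ext _ _ _ 3 _ h) => //.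
  apply/bcochainP; split=> [a c|].
    by rewrite /h -!mulgA (cup_primitive_shift pw qw).
  by have [K hK] := cup_primitive_bounded pw qw; exists K => c; exact: hK.
move=> s; rewrite /= /cochain_cup /= zE zE' !delta_counting.
rewrite /delta !big_ord_recl big_ord0 /h /= /bump /= !inordK //.
rewrite -[(2 + 1)%N]/3%N -[(2 + 2)%N]/4%N cup_primitive_delta !(add0n, add1n); ring.
Qed.

End CupVanishing.

(** * Walls along words *)

Section Walls.
Variables (V : finType) (E : rel V).
Hypotheses (E_sym : symmetric E) (E_irr : irreflexive E).
Variable F : {set V}.
Hypothesis F_indep : forall v v' : V, v \in F -> v' \in F -> ~~ E v v'.
Local Notation Gamma := (raag E).
Local Notation cls := (raag_class E).
Local Notation letter_val := (letter_val E).
Local Notation P := (path_crossings F).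
Local Notation freely_reduced := (reduced (@flip V)).
Local Open Scope group_scope.
Implicit Types (a b g y : Gamma) (l k : V * bool) (u w z : word V).

Definition in_F w := all (fun l => l.1 \in F) w.

Fixpoint walls g w : seq (set Gamma) :=
  if w is l :: w' then side (g * letter_val l) g :: walls (g * letter_val l) w' else [::].

Lemma walls_cat g u w : walls g (u ++ w) = walls g u ++ walls (g * cls u) w.
Proof.
elim: u g => [|l u IH] g /=; first by rewrite mulg1.
by rewrite IH (raag_class_cons E l) mulgA.
Qed.

Lemma size_walls g w : size (walls g w) = size w.
Proof. by elim: w g => //= l w IH g; rewrite IH. Qed.

Lemma translate_walls a g w : translate a (walls g w) = walls (a * g) w.
Proof.
elim: w g => [//|l w IH] g /=.
by rewrite /translate /= side_mul -[map _ _]/(translate a _) IH mulgA.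
Qed.

Definition crossing_letter (e : crossing E) : V * bool := (e.1.1, e.2).

Lemma crossing_letters g w : in_F w -> map crossing_letter (crossings F g w) = w.
Proof. by elim: w g => [//|[v s] w IH] g /= /andP[-> /IH /= ->]. Qed.

(** Forgetting the hyperplane sends [reverse] to [flip], so cancelling crossings would come from
    cancelling letters. *)
Lemma reduced_crossings g w : in_F w -> freely_reduced w ->
  reduced (@reverse V E) (crossings F g w).
Proof.
move=> wF; rewrite -{1}(crossing_letters g wF) /reduced sorted_map.
apply: sub_sorted => e e' /=; apply: contra => /eqP -> //.
Qed.

Lemma path_crossings_word g w : in_F w -> freely_reduced w ->
  P g (g * cls w) = crossings F g w.
Proof.
move=> wF wr; rewrite (path_crossingsE E_sym F_indep (w := w)) ?mulKg //.
by rewrite red_id // reduced_crossings.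
Qed.

Lemma crossings_memP g u l w : l.1 \in F ->
  cross_at (g * cls u) l \in crossings F g (u ++ l :: w).
Proof. by move=> lF; rewrite crossings_cat /= lF mem_cat mem_head orbT. Qed.

(** The label of [h] may lie outside [F]. The theory of crossings is therefore applied to the
    singleton of this label, which is independent because [E] is irreflexive. *)
Lemma halfspace_edge (h : set Gamma) g l : halfspace h ->
  ~ h g -> h (g * letter_val l) -> h = side (g * letter_val l) g.
Proof.
move=> /halfspace_letter[a [k ->]] ng hg.
have I : forall v v' : V, v \in [set k.1]%SET -> v' \in [set k.1]%SET -> ~~ E v v'.
  by move=> v v'; rewrite !inE => /eqP -> /eqP ->; rewrite E_irr.
have kI : k.1 \in [set k.1]%SET by rewrite inE.
have : cross_at a k \in path_crossings [set k.1]%SET g (g * letter_val l).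
  by apply/(mem_path_crossings E_sym I).
rewrite (path_crossings_letter E_sym I); case: ifP => // lI.
by rewrite inE => /eqP /(side_cross_at_eq E_sym I _ _ kI lI).
Qed.

(** Nestedness: no cancellation occurs when the first crossing is prepended. Tightness: a halfspace
    in between either contains the middle vertex or not, and so is dual to one of the two edges. *)
Lemma walls_tight g l k : l.1 \in F -> k.1 \in F -> k != flip l ->
  tightly_nested (side (g * letter_val l) g)
    (side (g * letter_val l * letter_val k) (g * letter_val l)).
Proof.
move=> lF kF kl; set a := g * letter_val l.
have nested : side (a * letter_val k) a `<=` side a g.
  move=> c; rewrite !(side_crossing E_sym F_indep) // => ac.
  rewrite (path_crossings_cat E_sym F_indep g a) (path_crossings_letter E_sym F_indep) lF.
  rewrite red_id // cat1s reduced_cons ac path_crossings_reduced andbT.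
  by apply: contra kl => /eqP/Some_inj/(congr1 crossing_letter); case: (k) (l) => [? ?] [? ?] [-> ->].
split=> // [e|[h [hh h1 h2 kh hl]]].
  by have := (side_self E_sym F_indep a kF).2; rewrite -e; apply; exact: (side_self E_sym F_indep g lF).1.
have [ha|nha] := pselect (h a).
  by apply: h1; apply: halfspace_edge => // /hl; exact: (side_self E_sym F_indep g lF).2.
by apply: h2; apply: halfspace_edge => //; apply: kh; exact: (side_self E_sym F_indep a kF).1.
Qed.

Lemma walls_segment g w : (0 < size w)%N -> in_F w -> freely_reduced w -> segment (walls g w).
Proof.
move=> w0 wF wr; split; first by rewrite size_walls.
  by elim: w g {w0 wF wr} => [//|l w IH] g h /=; rewrite inE => /orP[/eqP ->|/IH //]; exact: side_halfspace.
elim: w g {w0} wF wr => [//|l w IH] g /= /andP[lF wF].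
rewrite reduced_cons => /andP[lw wr] [|i] /=; last by move=> iw; exact: IH.
by case: w {IH wr} wF lw => [//|k w] /= /andP[kF _] kl _; exact: walls_tight.
Qed.

Lemma walls_head g w : (0 < size w)%N -> in_F w ->
  exists2 v, v \in F & has_label (head set0 (walls g w)) v.
Proof.
by case: w => [//|l w] _ /= /andP[lF _]; exists l.1 => //; exact: has_label_side.
Qed.

Lemma walls_last g w : (0 < size w)%N -> in_F w ->
  exists2 v, v \in F & has_label (last set0 (walls g w)) v.
Proof.
case/lastP: w => [//|w l] _; rewrite /in_F all_rcons -cats1 walls_cat last_cat /= => /andP[lF _].
by exists l.1 => //; exact: has_label_side.
Qed.

Lemma walls_crossings g g' w : in_F w -> crossings F g w = crossings F g' w -> walls g w = walls g' w.
Proof.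
elim: w g g' => [//|l w IH] g g' /= /andP[lF wF]; rewrite lF => /eqP.
rewrite eqseq_cons => /andP[/eqP e /eqP ew]; rewrite (IH _ (g' * letter_val l)) //.
by have /(side_cross_at_eq E_sym F_indep _ _ lF lF) -> := e.
Qed.


Lemma walls_memP g u h : h \in walls g u -> exists u1 l u2,
  u = u1 ++ l :: u2 /\ h = side (g * cls u1 * letter_val l) (g * cls u1).
Proof.
elim: u g => [//|l u IH] g /=; rewrite inE => /orP[/eqP ->|/IH[u1 [k [u2 [-> ->]]]]].
  by exists [::], l, u; rewrite mulg1.
by exists (l :: u1), k, u2; rewrite (raag_class_cons E l) mulgA.
Qed.

(** The letters of the crossings spell back the word read along the path, so windows of crossings
    become subwords of [z]. *)
Lemma translates_wallsP u z y t : (0 < size u)%N -> in_F u -> freely_reduced u ->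
  in_F z -> freely_reduced z ->
  translates_in (walls 1 u) y (y * cls z) t <->
  exists z1 z2, z = z1 ++ u ++ z2 /\ t = walls (y * cls z1) u.
Proof.
move=> u0 uF ur zF zr; have PE := path_crossings_word y zF zr; split; last first.
  move=> [z1 [z2 [zE ->]]]; split; first by exists (y * cls z1); rewrite translate_walls mulg1.
  move=> h /walls_memP[u1 [l [u2 [uE ->]]]].
  have lF : l.1 \in F by move: uF; rewrite uE /in_F all_cat => /and3P[].
  have : cross_at (y * cls z1 * cls u1) l \in P y (y * cls z).
    rewrite PE zE uE -mulgA -raag_classM -!catA catA cat_cons.
    exact: crossings_memP.
  move=> /(mem_path_crossings E_sym F_indep _ _ _ lF)[ny yh].
  by split=> //; exact: side_halfspace.
move=> [[g tE] tP]; rewrite translate_walls mulg1 in tE; subst t.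
have gs := walls_segment g u0 uF ur.
have [l [u' uE]] : exists l u', u = l :: u' by case: (u) u0 => // l u' _; exists l, u'.
have [u'' [k uE']] : exists u'' k, u = u'' ++ [:: k].
  by case/lastP: (u) u0 => [//|u'' k] _; exists u'', k; rewrite cats1.
have lF : l.1 \in F by move: uF; rewrite uE => /andP[].
have kF : k.1 \in F by move: uF; rewrite uE' /in_F all_cat /= andbT => /andP[].
have h0 : nth set0 (walls g u) 0 = side (g * letter_val l) g by rewrite uE.
have hl : nth set0 (walls g u) (size u).-1 =
    side (g * cls u'' * letter_val k) (g * cls u'').
  by rewrite uE' walls_cat nth_cat size_walls size_cat addn1 /= ltnn subnn.
have uk : (0 <= (size u).-1 < size u)%N by rewrite /= prednK.
have nested := segment_nested gs (i := 0) (j := (size u).-1).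
rewrite size_walls h0 hl in nested.
have m0 : nth set0 (walls g u) 0 \in walls g u by rewrite mem_nth ?size_walls.
have ml : nth set0 (walls g u) (size u).-1 \in walls g u by rewrite mem_nth ?size_walls ?prednK.
have [_ _ ny] := tP _ m0; have [_ yz _] := tP _ ml; rewrite h0 in ny; rewrite hl in yz.
have [s1 [s2]] := path_crossings_window E_sym F_indep lF kF (nested uk) ny yz.
rewrite PE -mulgA -raag_class_rcons -cats1 -uE' path_crossings_word // => sE.
have zE := congr1 (map crossing_letter) sE.
rewrite !map_cat !crossing_letters // in zE.
exists (map crossing_letter s1), (map crossing_letter s2); split=> //.
apply: walls_crossings => //; move: sE; rewrite {1}zE !crossings_cat.
have sF : in_F (map crossing_letter s1) by move: zF; rewrite zE /in_F !all_cat => /andP[].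
have sz w g' : in_F w -> size (crossings F g' w) = size w.
  by move=> wF; rewrite -[in RHS](crossing_letters g' wF) size_map.
by move=> /eqP; rewrite !eqseq_cat ?sz ?size_map // => /and3P[_ /eqP <-].
Qed.

End Walls.

(** * Occurrences of probe words in powers of commutators *)

Section TestWords.
Variables (V : finType) (v1 v2 : V).
Local Notation a := (v1, true).
Local Notation b := (v2, true).
Local Notation a' := (v1, false).
Local Notation b' := (v2, false).
Implicit Types (i j k n r : nat) (z : word V).

Definition commutator_word i : word V := nseq i a ++ nseq i b ++ nseq i a' ++ nseq i b'.
Definition test_word i n : word V := flatten (nseq n (commutator_word i)).
Definition probe_word j : word V := a :: nseq j b ++ [:: a'].

(** The letter at position [r] of the commutator word; with periodicity, occurrences of subwords
    become arithmetic modulo $4i$. *)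
Definition quarter i r : V * bool :=
  if (r < i)%N then a else if (r < 2 * i)%N then b else if (r < 3 * i)%N then a' else b'.

Lemma size_commutator_word i : size (commutator_word i) = (4 * i)%N.
Proof. by rewrite /commutator_word !size_cat !size_nseq; lia. Qed.

Lemma nth_commutator_word i r : (r < 4 * i)%N -> nth a (commutator_word i) r = quarter i r.
Proof.
move=> ri; rewrite /commutator_word !nth_cat !size_nseq !nth_nseq /quarter.
by repeat (case: ifP => ?; try by []); exfalso; lia.
Qed.

Lemma size_test_word i n : size (test_word i n) = (n * (4 * i))%N.
Proof.
by elim: n => [//|n IH]; rewrite /test_word /= size_cat -/(test_word i n) IH size_commutator_word mulSn.
Qed.

Lemma nth_test_word i n k : (k < n * (4 * i))%N ->
  nth a (test_word i n) k = quarter i (k %% (4 * i)).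
Proof.
elim: n k => [//|n IH] k kn; rewrite /test_word /= nth_cat size_commutator_word.
case: ltnP => ki; first by rewrite nth_commutator_word // modn_small.
by rewrite IH; [rewrite -{2}(subnK ki) modnDr|lia].
Qed.

(** Each period contains an occurrence that starts at the last letter of its first block, at offset
    [i] because the blocks have length [i.+1]. *)
Lemma test_word_probe i n k : (k < n)%N -> exists z1 z2,
  test_word i.+1 n = z1 ++ probe_word i.+1 ++ z2 /\ size z1 = (k * (4 * i.+1) + i)%N.
Proof.
move=> kn; have [m ->] : exists m, n = (k + m.+1)%N by exists (n - k.+1)%N; lia.
exists (test_word i.+1 k ++ nseq i a), (nseq i a' ++ nseq i.+1 b' ++ test_word i.+1 m).
split; last by rewrite size_cat size_test_word size_nseq.
have aE : nseq i.+1 a = nseq i a ++ [:: a] by rewrite -addn1 nseqD.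
rewrite {1}/test_word nseqD flatten_cat -!/(test_word _ _) -!catA; congr (_ ++ _).
rewrite -[test_word _ m.+1]/(commutator_word i.+1 ++ test_word i.+1 m).
by rewrite /commutator_word aE /probe_word -[a :: nseq _ _ ++ _]cat1s -!catA.
Qed.

Hypothesis v12 : v1 != v2.

Lemma reduced_test_word i n : (0 < i)%N -> reduced (@flip V) (test_word i n).
Proof.
move=> i0; apply/(sortedP a) => k; rewrite size_test_word => kn.
have N0 : (0 < 4 * i)%N by lia.
have v21 : (v2 == v1) = false by rewrite eq_sym (negbTE v12).
rewrite !nth_test_word //; last exact: ltnW.
have rN := ltn_pmod k N0; rewrite -addn1 -modnDml.
(* At the junction of two periods the inverse of [v2] is followed by [v1]. *)
have [e|rN1] := eqVneq (k %% (4 * i) + 1)%N (4 * i)%N.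
  rewrite e modnn; have -> : (k %% (4 * i) = 4 * i - 1)%N by lia.
  by rewrite /quarter; repeat (case: ifP => ?; rewrite ?xpair_eqE /= ?(negbTE v12) //); exfalso; lia.
rewrite modn_small; last by lia.
move: (k %% _)%N rN rN1 => r rN rN1; rewrite /quarter.
by repeat (case: ifP => ?; rewrite ?xpair_eqE /= ?andbF ?(negbTE v12) ?v21 //); exfalso; lia.
Qed.

Lemma reduced_probe_word j : (0 < j)%N -> reduced (@flip V) (probe_word j).
Proof.
case: j => // j _; rewrite /probe_word reduced_cons; apply/andP; split; first exact/eqP.
elim: j => [|j IH]; rewrite reduced_cons; last by rewrite IH andbT; apply/eqP.
by rewrite andbT; apply/eqP => -[e]; move: v12; rewrite e eqxx.
Qed.

(** The first two letters force the occurrence to start at position $i-1$ modulo $4i$; the run of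
    [v2] that follows has length exactly $i$ before the inverse of [v1] appears. *)
Lemma probe_word_infix i j n z1 z2 : (0 < i)%N -> (0 < j)%N ->
  test_word i n = z1 ++ probe_word j ++ z2 -> i = j.
Proof.
move=> i0 j0 zE; have N0 : (0 < 4 * i)%N by lia.
have sz := congr1 size zE; rewrite size_test_word !size_cat /= size_cat size_nseq /= in sz.
have nthE k : (k < j.+2)%N -> nth a (probe_word j) k = quarter i ((size z1 %% (4 * i) + k) %% (4 * i)).
  move=> kj; rewrite modnDml -(@nth_test_word _ n); last by lia.
  rewrite zE nth_cat (_ : (_ + k < _)%N = false); last by lia.
  rewrite addKn nth_cat.
  by rewrite (_ : (k < _)%N = true) //= size_cat size_nseq /= addn1.
have rN := ltn_pmod (size z1) N0; move: (_ %% _)%N nthE rN => r nthE rN.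
have ri : (r < i)%N.
  move: (nthE 0%N isT); rewrite addn0 modn_small // /quarter.
  by case: ifP => //= _; repeat case: ifP => _ // ; case=> e; move: v12; rewrite e eqxx.
have nb k : (k < j)%N -> b = quarter i ((r + k.+1) %% (4 * i)).
  by move=> kj; rewrite -nthE /= ?nth_cat ?size_nseq ?kj ?nth_nseq ?kj //; lia.
have na : a' = quarter i ((r + j.+1) %% (4 * i)).
  by rewrite -nthE /= ?nth_cat ?size_nseq ?ltnn ?subnn.
have r1 : (r.+1 = i)%N.
  move: (nb 0%N j0); rewrite modn_small; last by lia.
  rewrite /quarter; case: ifP => [_ [e]|]; last by lia.
  by move: v12; rewrite e eqxx.
have [ij|ij|//] := ltngtP i j.
  move: (nb i ij); rewrite modn_small; last by lia.
  by rewrite /quarter; repeat (case: ifP => ?; try by []); exfalso; lia.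
move: na; rewrite modn_small; last by lia.
by rewrite /quarter; repeat (case: ifP => ?; try by []); exfalso; lia.
Qed.

(** The inverse probe has [v1] followed by the inverse of [v2], whereas in the test word [v1] is
    followed by [v1] or [v2]. *)
Lemma probe_word_inv_infix i j n z1 z2 : (0 < i)%N -> (0 < j)%N ->
  test_word i n <> z1 ++ word_inv (probe_word j) ++ z2.
Proof.
move=> i0 j0 zE; have N0 : (0 < 4 * i)%N by lia.
have sz := congr1 size zE; rewrite size_test_word !size_cat /word_inv size_rev size_map in sz.
rewrite /= size_cat size_nseq /= in sz.
have nthE k : (k < j.+2)%N ->
    nth a (word_inv (probe_word j)) k = quarter i ((size z1 %% (4 * i) + k) %% (4 * i)).
  move=> kj; rewrite modnDml -(@nth_test_word _ n); last by lia.
  rewrite zE nth_cat (_ : (_ + k < _)%N = false); last by lia.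
  rewrite addKn nth_cat.
  by rewrite (_ : (k < _)%N = true) // /word_inv size_rev size_map /= size_cat size_nseq /= addn1.
have wE : word_inv (probe_word j) = a :: nseq j b' ++ [:: a'].
  by rewrite /word_inv /probe_word /= map_cat map_nseq rev_cons rev_cat /= -cats1 rev_nseq.
rewrite wE in nthE.
have rN := ltn_pmod (size z1) N0; move: (_ %% _)%N nthE rN => r nthE rN.
have ri : (r < i)%N.
  move: (nthE 0%N isT); rewrite addn0 modn_small // /quarter.
  by case: ifP => //= _; repeat case: ifP => _ // ; case=> e; move: v12; rewrite e eqxx.
move: (nthE 1%N isT); rewrite modn_small; last by lia.
case: j j0 {sz nthE wE zE} => //= j _.
by rewrite /quarter; repeat (case: ifP => ?; try by []); exfalso; lia.
Qed.

End TestWords.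

(** * Linear independence *)

Section LinearDependence.
Variables (R : fieldType) (U : lmodType R).

Lemma lspan_coord (s : seq U) u : lspan [set` s] u ->
  exists c : 'I_(size s) -> R, u = \sum_j c j *: s`_j.
Proof.
move=> [n [c [w [ws ->]]]].
exists (fun j => \sum_(i < n | index (w i) s == j :> nat) c i).
under [RHS]eq_bigr do rewrite scaler_suml.
rewrite (exchange_big_dep xpredT) //=; apply: eq_bigr => i _.
have wis : (index (w i) s < size s)%N by rewrite index_mem; exact: ws.
rewrite (big_pred1 (Ordinal wis)) /=; first by rewrite nth_index //; exact: ws.
by move=> j; rewrite /= eq_sym.
Qed.

(** One vector more than there are spanning vectors: the coordinate matrix has more rows than
    columns, and a nonzero row of its left kernel gives the coefficients. *)
Lemma finite_dim_dependent (A : set U) : finite_dim A -> exists N, forall w : 'I_N -> U,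
  (forall i, A (w i)) -> exists2 c : 'I_N -> R, (exists i, c i != 0) & \sum_i c i *: w i = 0.
Proof.
move=> [s ->]; exists (size s).+1 => w ws.
have [C wE] := choice (fun i => lspan_coord (ws i)).
pose M := \matrix_(i < (size s).+1, j < size s) C i j.
have K0 : kermx M != 0.
  rewrite -mxrank_eq0 mxrank_ker subn_eq0 -ltnNge ltnS; exact: rank_leq_col.
have [r /eqP rM r0] : exists2 r : 'rV_(size s).+1, r *m M == 0 & r != 0.
  exists (nz_row (kermx M)); last by rewrite nz_row_eq0.
  by apply/eqP/sub_kermxP; exact: nz_row_sub.
exists (fun i => r 0 i).
  by have /rV0Pn[i ri] := r0; exists i.
under eq_bigr do rewrite wE scaler_sumr.
rewrite exchange_big big1 // => j _; under eq_bigr do rewrite scalerA.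
rewrite -scaler_suml; have /rowP/(_ j) := rM; rewrite !mxE => rMj.
by rewrite (_ : \sum_i _ = 0) ?scale0r // -[RHS]rMj; apply: eq_bigr => i _; rewrite mxE.
Qed.

End LinearDependence.

(** * Trivial classes and homomorphisms *)

Section Classes.
Variables (R : realType) (G : groupType).

(** Subtracting a bounded primitive from [hat f] leaves an invariant 1-cocycle, which is a
    homomorphism, at bounded distance from [f]. *)
Lemma hat_coboundary_hom (f : G -> R) : is_bcoboundary (delta (hat f) : cochain R G 2) ->
  exists (h : G -> R) B, {morph h : a b / (a * b)%g >-> a + b} /\ forall a, `|f a - h a| <= B.
Proof.
move=> [b /bcochainP[b_inv [B bB]] db].
pose k : cochain R G 1 := hat f - b.
have dk : delta k = 0 by rewrite linearB /= db subrr.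
have kinv a c : k (fun i => a * c i)%g = k c.
  by rewrite -[LHS]/(hat f _ - b _) b_inv /hat invgM -mulgA mulKg.
pose pr a a' : 'I_2 -> G := fun i => if i == ord0 then a else a'.
exists (fun a => k (pr 1%g a)), B; split=> [a a'|a]; last first.
  by rewrite -[k _]/(hat f _ - b _) /hat /= invg1 mul1g opprB addrC addrNK.
(* The cocycle identity is evaluated at $(1,a,aa')$; invariance turns $k(a,aa')$ into $k(1,a')$. *)
pose c : 'I_3 -> G := fun i => nth 1%g [:: 1; a; a * a']%g i.
have := congr1 (fun z : cochain R G 2 => z c) dk; rewrite /delta !big_ord_recl big_ord0 /=.
have -> : (fun j => c (lift ord0 j)) = (fun i => a * pr 1 a' i)%g.
  by apply/funext => -[[|[|//]] ?]; rewrite /c /pr /= ?mulg1.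
have -> : (fun j => c (lift (lift ord0 ord0) j)) = pr 1%g (a * a')%g.
  by apply/funext => -[[|[|//]] ?].
have -> : (fun j => c (lift (lift ord0 (lift ord0 ord0)) j)) = pr 1%g a.
  by apply/funext => -[[|[|//]] ?].
rewrite kinv -[(0 : cochain R G 2) c]/(0 : R) expr0 mul1r expr1 mulN1r -signr_odd /= expr0 mul1r.
by move=> h; apply/eqP; rewrite -subr_eq0 -oppr_eq0 -[eqbRHS]h; apply/eqP; ring.
Qed.

End Classes.

Section MedianClass.
Variables (R : realType) (V : finType) (E : rel V).
Hypothesis E_sym : symmetric E.
Variables (x : raag E) (F : {set V}).
Hypothesis F_indep : forall v v' : V, v \in F -> v' \in F -> ~~ E v v'.
Local Notation Gamma := (raag E).

Lemma counting_cochain_bcocycle phi D (M : R) : @counting_weight R V E phi D M ->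
  delta (counting_cochain x F phi) \in bcocycle R Gamma 2.
Proof.
move=> [p1 p2 p3 p4]; rewrite bcocycleE; apply/andP; split.
  apply/bcochainP; split=> [a c|].
    by rewrite !delta_counting -!mulgA !path_crossings_shift // !(wsum_map (p4 a)).
  exists (3 * (M * D%:R ^+ 2)) => c; rewrite delta_counting.
  set y0 := (c (inord 0) * x)%g; set y1 := (c _ * x)%g; set y2 := (c _ * x)%g.
  have := count_qm_defect (@reverseK V E) p1 p2 p3 (path_crossings F y0 y1) (path_crossings F y1 y2).
  rewrite /count_qm -path_crossings_cat // !red_id ?path_crossings_reduced //.
  rewrite !ler_norml; lra.
apply/eqP/funext => c.
rewrite /delta /counting_cochain !big_ord_recl !big_ord0 /=.
have -> : c = (fun i => (fun k => c (inord k)) (val i)).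
  by apply/funext => i; rewrite inord_val.
rewrite -[RHS]/(0 : R) /= /bump /= !(add0n, add1n).
ring.
Qed.

Lemma median_class_exists (s : seq (set Gamma)) : segment s ->
  (exists2 v, v \in F & has_label (head set0 s) v) ->
  (exists2 v, v \in F & has_label (last set0 s) v) ->
  exists z : bZ R Gamma 2, bZ_val z = delta (hat (median_qm R s x)).
Proof.
move=> ss sh sl.
have [phi [D [M [pw ->]]]] := median_counting_weight R E_sym x F_indep ss sh sl.
by exists (BZ (counting_cochain_bcocycle pw)).
Qed.

End MedianClass.

(** * Evaluation of the probe classes on test elements *)

Section Probes.
Variables (R : realType) (V : finType) (E : rel V).
Hypotheses (E_sym : symmetric E) (E_irr : irreflexive E).
Variables (x : raag E) (F : {set V}).
Hypothesis F_indep : forall v v' : V, v \in F -> v' \in F -> ~~ E v v'.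
Variables v1 v2 : V.
Hypotheses (v1F : v1 \in F) (v2F : v2 \in F) (v12 : v1 != v2).
Local Notation Gamma := (raag E).
Local Notation cls := (raag_class E).
Local Notation probe j := (walls (1%g : Gamma) (probe_word v1 v2 j.+1)).
Local Notation test i n := (test_word v1 v2 i.+1 n).

Lemma in_F_probe_word j : in_F F (probe_word v1 v2 j).
Proof. by rewrite /in_F /= v1F all_cat all_nseq /= v1F v2F orbT. Qed.

Lemma in_F_test_word i n : in_F F (test_word v1 v2 i n).
Proof.
elim: n => [//|n IH]; rewrite /test_word /= /in_F all_cat -/(in_F _ _) -/(in_F _ _) IH andbT.
by rewrite /in_F !all_cat !all_nseq /= v1F v2F !orbT.
Qed.

Lemma in_F_word_inv z : in_F F (word_inv z) = in_F F z.
Proof. by rewrite /in_F /word_inv all_rev all_map. Qed.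

Lemma probe_segment j : segment (probe j).
Proof.
by apply: (walls_segment E_sym E_irr F_indep) => //; [exact: in_F_probe_word|exact: reduced_probe_word].
Qed.

Lemma translates_probeP j i n y t :
  translates_in (probe j) y (y * cls (test i n))%g t <->
  exists z1 z2, test i n = z1 ++ probe_word v1 v2 j.+1 ++ z2 /\
    t = walls (y * cls z1)%g (probe_word v1 v2 j.+1).
Proof.
apply: (translates_wallsP E_sym E_irr F_indep) => //.
- exact: in_F_probe_word.
- exact: reduced_probe_word.
- exact: in_F_test_word.
exact: reduced_test_word.
Qed.

Lemma translates_probe_back j i n y :
  translates_in (probe j) (y * cls (test i n))%g y = set0.
Proof.
apply/seteqP; split=> // t.
rewrite -{2}(mulgK (cls (test i n)) y) -raag_class_inv.
have uF := in_F_probe_word j.+1; have ur := reduced_probe_word v12 (ltn0Sn j).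
have zF : in_F F (word_inv (test i n)) by rewrite in_F_word_inv in_F_test_word.
have zr : reduced (@flip V) (word_inv (test i n)).
  by rewrite -[word_inv _]/(winv (@flip V) _) reduced_winv ?reduced_test_word //; exact: flipK.
have u0 : (0 < size (probe_word v1 v2 j.+1))%N by [].
move=> /(translates_wallsP E_sym E_irr F_indep _ _ u0 uF ur zF zr)[z1 [z2 [zE _]]].
have := congr1 (@word_inv V) zE; rewrite word_invK.
rewrite [RHS](_ : _ = winv (@flip V) (z1 ++ probe_word v1 v2 j.+1 ++ z2)) // !winv_cat -catA.
exact: probe_word_inv_infix.
Qed.

(** Conjugating by [x] gives $\gamma x=xw$ for the test word $w$, so the path from [x] to $\gamma x$
    reads exactly $w$. *)
Lemma median_qm_probe_neq j i n : j != i ->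
  median_qm R (probe j) x (x * cls (test i n) * x^-1)%g = 0.
Proof.
move=> ji; rewrite /median_qm mulgVK /median_count translates_probe_back.
rewrite (_ : translates_in _ _ _ = set0) ?subrr //; apply/seteqP; split=> // t.
move=> /translates_probeP[z1 [z2 [/(probe_word_infix v12) e _]]].
by have [ij] := e (ltn0Sn _) (ltn0Sn _); rewrite ij eqxx in ji.
Qed.

Lemma median_qm_probe_eq i n :
  n%:R <= median_qm R (probe i) x (x * cls (test i n) * x^-1)%g.
Proof.
rewrite /median_qm mulgVK /median_count translates_probe_back fset_set0 cardfs0 subr0 ler_nat.
set T := translates_in _ _ _; set u := probe_word v1 v2 i.+1.
pose z1 k := take (k * (4 * i.+1) + i) (test i n).
have z1P k : (k < n)%N -> exists z2, test i n = z1 k ++ u ++ z2.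
  move=> /(test_word_probe v1 v2 i)[z [z2 [zE zs]]]; exists z2.
  by rewrite {1}zE /z1 zE -zs take_size_cat.
pose t k := walls (x * cls (z1 k))%g u.
have tT k : (k < n)%N -> T (t k).
  by move=> /z1P[z2 zE]; apply/translates_probeP; exists (z1 k), z2.
(* Finiteness is essential for the lower bound, as [fset_set] would otherwise be empty. Every
   translate found starts at one of the prefixes of the test word. *)
have Tfin : finite_set T.
  apply: (sub_finite_set (B := (fun k => walls (x * cls (take k (test i n)))%g u) @` `I_(size (test i n)).+1)).
    move=> t' /translates_probeP[z [z2 [zE ->]]]; exists (size z).
      by rewrite /= zE size_cat; lia.
    by rewrite zE take_size_cat.
  by apply: finite_image; exact: finite_II.
have tI k k' : (k < n)%N -> (k' < n)%N -> t k = t k' -> k = k'.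
  move=> kn k'n /(congr1 (head set0)) /=.
  have lF : (v1, true).1 \in F by [].
  move=> /(side_cross_at_eq E_sym F_indep _ _ lF lF) e.
  have PE := path_crossings_word E_sym F_indep x (in_F_test_word i.+1 n) (reduced_test_word v12 n (ltn0Sn i)).
  have U := path_crossings_uniq E_sym F_indep x (x * cls (test i n))%g; rewrite PE in U.
  have nthE m : (m < n)%N -> exists s1 s2, crossings F x (test i n) =
      s1 ++ cross_at (x * cls (z1 m))%g (v1, true) :: s2 /\ size s1 = (m * (4 * i.+1) + i)%N.
    move=> mn; have [z2 zE] := z1P m mn.
    exists (crossings F x (z1 m)), (crossings F (x * cls (z1 m) * letter_val E (v1, true))%g (behead u ++ z2)).
    split; first by rewrite {1}zE crossings_cat /= v1F.
    have zF : in_F F (z1 m).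
      by have := in_F_test_word i.+1 n; rewrite zE /in_F all_cat => /andP[].
    rewrite -(size_map (@crossing_letter V E)) crossing_letters // /z1 size_takel // size_test_word.
    nia.
  have [s1 [s2 [E1 S1]]] := nthE k kn; have [s3 [s4 [E2 S2]]] := nthE k' k'n.
  have I1 : index (cross_at (x * cls (z1 k))%g (v1, true)) (crossings F x (test i n)) = size s1.
    rewrite E1 index_cat; move: U; rewrite E1 cat_uniq => /and3P[_ /hasPn/(_ _ (mem_head _ _)) /negbTE -> _].
    by rewrite /= eqxx addn0.
  have I2 : index (cross_at (x * cls (z1 k'))%g (v1, true)) (crossings F x (test i n)) = size s3.
    rewrite E2 index_cat; move: U; rewrite E2 cat_uniq => /and3P[_ /hasPn/(_ _ (mem_head _ _)) /negbTE -> _].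
    by rewrite /= eqxx addn0.
  move: I1; rewrite e I2 S1 S2; nia.
have -> : n = size (map t (iota 0 n)) by rewrite size_map size_iota.
apply: uniq_leq_size.
  rewrite map_inj_in_uniq ?iota_uniq // => k k'; rewrite !mem_iota => kn k'n; exact: tI.
move=> _ /mapP[k + ->]; rewrite mem_iota => kn.
by rewrite -[_ \in enum_fset _]/(_ \in fset_set T) in_fset_set // inE; exact: tT.
Qed.

Lemma hom_test_word (h : Gamma -> R) i n : {morph h : a b / (a * b)%g >-> a + b} ->
  h (x * cls (test i n) * x^-1)%g = 0.
Proof.
move=> hM; have h1 : h 1%g = 0 by apply: (@addrI _ (h 1%g)); rewrite -hM mulg1 addr0.
have hV a : h a^-1%g = - h a by apply: (@addrI _ (h a)); rewrite -hM mulgV h1 subrr.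
rewrite !hM hV addrAC subrr add0r.
have hnseq m l : h (cls (nseq m l)) = h (letter_val E l) *+ m.
  by elim: m => [|m IH]; rewrite /= ?mulr0n // (raag_class_cons E l) hM IH mulrS.
elim: n => [//|n IH]; move: i.+1 IH => {}i IH.
rewrite -[test_word _ _ _ n.+1]/(commutator_word v1 v2 i ++ test_word v1 v2 i n).
rewrite raag_classM hM IH addr0 !raag_classM !hM !hnseq -[(v1, false)]/(flip (v1, true)) -[(v2, false)]/(flip (v2, true)).
by rewrite !letter_val_flip !hV !mulNrn; ring.
Qed.

(** A linear relation between probe classes puts a combination of their quasimorphisms at bounded
    distance from a homomorphism. On the test elements for an index with nonzero coefficient the
    homomorphism vanishes and only that one term survives, growing with [n]. *)
Theorem median_span_infinite : ~ finite_dim (median_span R x F).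
Proof.
move=> /finite_dim_dependent[N dep].
have cls_ex i : exists z : bZ R Gamma 2, bZ_val z = delta (hat (median_qm R (probe i) x)).
  apply: (median_class_exists _ E_sym _ F_indep); first exact: probe_segment.
    by apply: walls_head => //; exact: in_F_probe_word.
  by apply: walls_last => //; exact: in_F_probe_word.
have [z zE] := choice cls_ex.
have [i|c [i0 ci0] cz] := dep (fun i => bclass (z i)).
  exists 1%N, (fun=> 1), (fun=> bclass (z i)); split; last by rewrite big_ord1 scale1r.
  move=> _; exists (probe i); split; first exact: probe_segment.
  - by apply: walls_head => //; exact: in_F_probe_word.
  - by apply: walls_last => //; exact: in_F_probe_word.
  by exists (z i).
pose f g : R := \sum_i c i * median_qm R (probe (i : nat)) x g.
have : is_bcoboundary (bZ_val (\sum_i c i *: z i - 0)).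
  apply/bclass_eqP; have bclass0 : bclass (0 : bZ R Gamma 2) = 0.
    by rewrite -[RHS](subrr (bclass (0 : bZ R Gamma 2))) -bclassB subrr.
  rewrite bclass0 -[RHS]cz; apply: (big_ind2 (fun u v => bclass u = v)) => //.
    by move=> u _ v _ <- <-; rewrite bclassD.
  by move=> i _; rewrite bclassZ.
rewrite subr0 (_ : bZ_val _ = delta (hat f)); last first.
  have -> : hat f = \sum_i c i *: hat (median_qm R (probe (i : nat)) x).
    apply/funext => a.
    by rewrite (big_morph (fun k : cochain R Gamma 1 => k a) (op1 := +%R) (id1 := 0)).
  rewrite -[bZ_val _]/(val _) raddf_sum linear_sum; apply: eq_bigr => i _.
  by rewrite !linearZ /= zE.
move=> /hat_coboundary_hom[h [B [hM hB]]].
have B0 : 0 <= B by apply: le_trans (hB 1%g).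
(* Chosen so that $n\,|c_{i_0}|$ exceeds the distance [B] to the homomorphism. *)
pose n := Num.bound (B / `|c i0|).
have := hB (x * cls (test i0 n) * x^-1)%g; rewrite (hom_test_word _ _ hM) subr0.
rewrite /f (bigD1 i0) //= big1 ?addr0; last first.
  by move=> i ii0; rewrite median_qm_probe_neq ?mulr0.
have c0 : 0 < `|c i0| by rewrite normr_gt0.
have : B < n%:R * `|c i0|.
  rewrite -ltr_pdivrMr //; apply: archi_boundP; rewrite divr_ge0 //.
have := median_qm_probe_eq i0 n; set m := median_qm _ _ _ _ => nm.
rewrite normrM => h1 h2; have := le_lt_trans h2 h1; rewrite mulrC ltr_pM2r // => h3.
by have := le_lt_trans (ler_norm m) h3; rewrite ltNge nm.
Qed.

End Probes.

Theorem proposition5p7 (R : realType) (V : finType) (E : rel V)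
    (E_sym : symmetric E) (E_irr : irreflexive E) (x : raag E) (F : {set V})
    (F_indep : forall v w, v \in F -> w \in F -> ~~ E v w)
    (F_card : (2 <= #|F|)%N) :
  ~ finite_dim (median_span R x F) /\
  (forall phi psi : Hb R (raag E) 2,
     median_span R x F phi -> median_span R x F psi ->
     Hb_cup phi psi = 0 :> Hb R (raag E) 4).
Proof.
split=> [|phi psi hphi hpsi].
  have /card_gt1P[v1 [v2 [v1F v2F v12]]] := F_card.
  exact: (median_span_infinite E_sym E_irr F_indep v1F v2F v12).
have counting u : median_span R x F u -> counting_class x F u.
  by move=> hu; apply: median_span_counting hu.
exact: (cup_counting_class E_sym F_indep (counting _ hphi) (counting _ hpsi)).
Qed.
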